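(* Let $F$ be Thompson's group, viewed as a group of homeomorphisms of the circle $\mathbb{S}^1$. Suppose that $F$ is non-amenable. Then any countable subgroup $G\le\mathrm{Homeo}(\mathbb{S}^1)$ containing $F$ must be $C^\ast$-simple.
   Context: Let $\mathbb{S}^1=\mathbb{R}/\mathbb{Z}$. Thompson's group $F$ is the group of orientation preserving homeomorphisms of $\mathbb{S}^1$ fixing the point $0$ which are piecewise linear with only finitely many breakpoints, all at dyadic rationals, and slopes in $2^{\mathbb{Z}}$. A group is $C^\ast$-simple if its reduced $C^\ast$-algebra is simple. *)

(* Defs.v *)
From HB Require Import structures.
From mathcomp Require Import all_boot all_order all_algebra.
From mathcomp Require Import generic_quotient complex ring lra.
From mathcomp Require Import all_classical all_reals all_analysis.

Set Implicit Arguments.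
Unset Strict Implicit.
Unset Printing Implicit Defensive.

Import Order.TTheory GRing.Theory Num.Theory.
Import numFieldNormedType.Exports.

Local Open Scope classical_set_scope.
Local Open Scope ring_scope.
Local Open Scope quotient_scope.

Section Homeo.
Variable T : topologicalType.

Record homeo : Type := Homeo {
  homeo_fun :> T -> T;
  homeo_inv : T -> T;
  homeoK : cancel homeo_fun homeo_inv;
  homeoVK : cancel homeo_inv homeo_fun;
  homeo_continuous : continuous homeo_fun;
  homeo_inv_continuous : continuous homeo_inv }.

Lemma homeoP (f g : homeo) : f =1 g -> f = g.
Proof.
case: f g => [f f' fK f'K cf cf'] [g g' gK g'K cg cg'] /= fg.
have {}fg : f = g by apply/funext.
subst g.
have fg' : f' = g' by apply/funext => x; apply: (can_inj fK); rewrite f'K g'K.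
by subst g'; congr Homeo; apply: Prop_irrelevance.
Qed.

HB.instance Definition _ := gen_eqMixin homeo.
HB.instance Definition _ := gen_choiceMixin homeo.

Definition homeo_one : homeo :=
  @Homeo idfun idfun (fun=> erefl) (fun=> erefl) (fun=> cvg_id) (fun=> cvg_id).

Definition homeo_opp (f : homeo) : homeo :=
  Homeo (homeoVK f) (homeoK f) (@homeo_inv_continuous f) (@homeo_continuous f).

Lemma homeo_mul_continuous (f g : T -> T) :
  continuous f -> continuous g -> continuous (f \o g).
Proof. by move=> cf cg x; apply: continuous_comp; [exact: cg|exact: cf]. Qed.

Definition homeo_mul (f g : homeo) : homeo :=
  Homeo (can_comp (homeoK f) (homeoK g)) (can_comp (homeoVK g) (homeoVK f))
    (homeo_mul_continuous (@homeo_continuous f) (@homeo_continuous g))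
    (homeo_mul_continuous (@homeo_inv_continuous g) (@homeo_inv_continuous f)).

Lemma homeo_mulA : associative homeo_mul.
Proof. by move=> f g h; apply: homeoP. Qed.
Lemma homeo_mul1 : left_id homeo_one homeo_mul.
Proof. by move=> f; apply: homeoP. Qed.
Lemma homeo_1mul : right_id homeo_one homeo_mul.
Proof. by move=> f; apply: homeoP. Qed.
Lemma homeo_mulV : left_inverse homeo_one homeo_opp homeo_mul.
Proof. by move=> f; apply: homeoP => x /=; rewrite homeoK. Qed.
Lemma homeo_Vmul : right_inverse homeo_one homeo_opp homeo_mul.
Proof. by move=> f; apply: homeoP => x /=; rewrite homeoVK. Qed.

HB.instance Definition _ := isGroup.Build homeo
  homeo_mulA homeo_mul1 homeo_1mul homeo_mulV homeo_Vmul.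

End Homeo.

Section Subgroup.
Variables (G : groupType) (H : groupClosed G).

Definition subgroup : Type := {x : G | x \in H}.

HB.instance Definition _ := SubChoice.on subgroup.

Lemma subgroup_closed : group_closed (fun x : G => x \in H).
Proof. by split; [exact: gpred1|exact: gpredF]. Qed.

HB.instance Definition _ :=
  SubChoice_isSubGroup.Build G (fun x : G => x \in H) subgroup subgroup_closed.

End Subgroup.

Section Circle.
Variable R : realType.

Definition circle_rel (x y : R) : bool := x - y \is a Num.int.

Lemma circle_relxx : reflexive circle_rel.
Proof. by move=> x; rewrite /circle_rel subrr int_num0. Qed.
Lemma circle_relC : symmetric circle_rel.
Proof. by move=> x y; rewrite /circle_rel -opprB rpredN. Qed.
Lemma circle_rel_trans : transitive circle_rel.
Proof.
move=> y x z; rewrite /circle_rel => xy yz.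
have -> : x - z = (x - y) + (y - z) by ring.
exact: rpredD.
Qed.

Canonical circle_equiv := EquivRel circle_rel
  circle_relxx circle_relC circle_rel_trans.

Definition circle : topologicalType := quotient_topology {eq_quot circle_equiv}.

Definition circle_pi (x : R) : circle :=
  \pi_({eq_quot circle_equiv}) x.

Lemma circle_piP (x y : R) : circle_pi x = circle_pi y <-> x - y \is a Num.int.
Proof.
by split=> [h|h]; [apply/(eqmodP circle_equiv)|apply/(eqmodP circle_equiv)].
Qed.

End Circle.

Section ThompsonF.
Variable R : realType.
Implicit Types (x y a b : R) (g : R -> R) (s : seq R).

(* Orientation preserving homeomorphisms of R/Z are those induced by an
   increasing homeomorphism of R commuting with the translation by 1. *)
Definition increasing_lift (h : circle R -> circle R) (g : R -> R) : Prop :=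
  [/\ continuous g, {homo g : x y / x < y}, forall x, g (x + 1) = g x + 1 &
      forall x, circle_pi (g x) = h (circle_pi x)].

Definition orientation_preserving (h : circle R -> circle R) : Prop :=
  exists g, increasing_lift h g.

Definition dyadic (x : R) : Prop :=
  exists (m : int) (n : nat), x = m%:~R / 2 ^+ n.

(* For s = [:: t_1; ...; t_n], the points a = t_0 < t_1 < ... < t_n subdivide
   [a, t_n], the t_i (i > 0) are dyadic and g is affine with slope in 2^Z on
   each [t_i, t_(i+1)]. *)
Fixpoint dyadic_pieces (g : R -> R) (a : R) (s : seq R) : Prop :=
  if s is b :: s' then
    [/\ a < b, dyadic b,
        exists k : int, forall x, a <= x <= b -> g x = g a + 2 ^ k * (x - a) &
        dyadic_pieces g b s']
  else True.

Definition dyadic_PL (g : R -> R) (a b : R) : Prop :=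
  exists2 s, last a s = b & dyadic_pieces g a s.

(* A lift is determined by its restriction to the fundamental domain [0, 1]. *)
Definition is_thompsonF (h : circle R -> circle R) : Prop :=
  [/\ orientation_preserving h, h (circle_pi 0) = circle_pi 0 &
      exists2 g, increasing_lift h g & dyadic_PL g 0 1].

Definition thompsonF : {pred homeo (circle R)} :=
  [pred h : homeo (circle R) | `[< is_thompsonF h >]].

Lemma dyadic_int (m : int) : dyadic m%:~R.
Proof. by exists m, 0; rewrite expr0 divr1. Qed.

Lemma dyadicD x y : dyadic x -> dyadic y -> dyadic (x + y).
Proof.
move=> [m [n ->]] [p [q ->]]; exists (m * 2 ^+ q + p * 2 ^+ n), (n + q)%N.
rewrite rmorphD !rmorphM /= !rmorphXn /= exprD.
have h2 k : (2 : R) ^+ k != 0 by rewrite expf_neq0 // pnatr_eq0.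
by field; rewrite !h2.
Qed.

Lemma dyadicN x : dyadic x -> dyadic (- x).
Proof. by move=> [m [n ->]]; exists (- m), n; rewrite rmorphN /= mulNr. Qed.

Lemma dyadicZ (k : int) x : dyadic x -> dyadic (2 ^ k * x).
Proof.
have h2 j : (2 : R) ^+ j != 0 by rewrite expf_neq0 // pnatr_eq0.
move=> [m [n ->]]; case: k => k.
  exists (m * 2 ^+ k), n; rewrite -exprnP rmorphM rmorphXn /=.
  by rewrite mulrCA mulrA.
exists m, (n + k.+1)%N; rewrite NegzE -exprnN exprD.
by field; rewrite !h2.
Qed.

Lemma dyadic_PL_nil g a : dyadic_PL g a a.
Proof. by exists [::]. Qed.

Lemma dyadic_PL_cons g a b c (k : int) : a < b -> dyadic b ->
  (forall x, a <= x <= b -> g x = g a + 2 ^ k * (x - a)) ->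
  dyadic_PL g b c -> dyadic_PL g a c.
Proof. by move=> ab db gE [s <- ps]; exists (b :: s) => //=; split => //; exists k. Qed.

Lemma dyadic_PL_ind g (P : R -> R -> Prop) :
  (forall a, P a a) ->
  (forall a b c (k : int), a < b -> dyadic b ->
    (forall x, a <= x <= b -> g x = g a + 2 ^ k * (x - a)) ->
    dyadic_PL g b c -> b <= c -> P b c -> P a c) ->
  forall a c, dyadic_PL g a c -> P a c.
Proof.
move=> P0 PS a c [s <- ps]; suff [] : a <= last a s /\ P a (last a s) by [].
elim: s a ps => [|b s IH] a /=; first by [].
move=> [ab db [k gE] ps]; have [bl Pb] := IH b ps; split.
  exact: ltW (lt_le_trans ab bl).
by apply: (PS a b _ k) => //; exists s.
Qed.

Lemma dyadic_PL_cat g a b c :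
  dyadic_PL g a b -> dyadic_PL g b c -> dyadic_PL g a c.
Proof.
move=> PL; move: a b PL c; apply: dyadic_PL_ind => // a b d k ab db gE _ _ IH c.
by move=> /IH; exact: dyadic_PL_cons gE.
Qed.

Lemma dyadic_PL_split g a b c : dyadic_PL g a c -> dyadic b -> a <= b <= c ->
  dyadic_PL g a b /\ dyadic_PL g b c.
Proof.
move=> PL; move: a c PL b; apply: dyadic_PL_ind => [a b db|].
  by move=> /le_anti <-; split; exact: dyadic_PL_nil.
move=> a b' c k ab' db' gE PL b'c IH b db /andP[ab bc].
have [b'b|bb'] := leP b' b.
  have [||P1 P2] := IH b => //; first by rewrite b'b bc.
  by split => //; exact: dyadic_PL_cons gE P1.
move: ab; rewrite le_eqVlt => /predU1P[<-|ab].
  by split; [exact: dyadic_PL_nil|exact: dyadic_PL_cons gE PL].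
split.
  apply: (@dyadic_PL_cons g a b b k) => //; last exact: dyadic_PL_nil.
  by move=> x /andP[ax xb]; apply: gE; rewrite ax (le_trans xb) ?ltW.
apply: (@dyadic_PL_cons g b b' c k) => // x /andP[bx xb'].
rewrite (gE x) ?xb' ?(le_trans (ltW ab) bx) // (gE b) ?(ltW ab) ?(ltW bb') //.
by ring.
Qed.

Lemma affine_comp f g a b (k : int) : a < b ->
  (forall x, a <= x <= b -> g x = g a + 2 ^ k * (x - a)) ->
  dyadic a -> dyadic (g a) ->
  dyadic_PL f (g a) (g b) -> dyadic_PL (f \o g) a b.
Proof.
move=> ab gE da dga PL.
have k0 : (0 : R) < 2 ^ k by rewrite exprz_gt0.
pose q y := a + 2 ^ (- k) * (y - g a).
have kK : (2 : R) ^ k * 2 ^ (- k) = 1 by rewrite -invr_expz divff // gt_eqF.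
have gb : g b = g a + 2 ^ k * (b - a) by rewrite gE // lexx ltW.
have qgb : q (g b) = b.
  rewrite /q gb; transitivity (a + (2 ^ k * 2 ^ (- k)) * (b - a)); first by ring.
  by rewrite kK mul1r addrC subrK.
have gq y : g a <= y -> y <= g b -> [/\ a <= q y, q y <= b & g (q y) = y].
  move=> h1 h2.
  have aq : a <= q y by rewrite lerDl mulr_ge0 ?exprz_ge0 // subr_ge0.
  have qb : q y <= b by rewrite -qgb lerD2l ler_pM2l ?exprz_gt0 // lerD2r.
  split => //; rewrite gE ?aq ?qb // /q.
  transitivity (g a + (2 ^ k * 2 ^ (- k)) * (y - g a)); first by ring.
  by rewrite kK mul1r addrC subrK.
have dq y : dyadic y -> dyadic (q y).
  by move=> dy; apply: dyadicD => //; apply/dyadicZ/dyadicD => //; exact: dyadicN.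
have H : forall u v, dyadic_PL f u v -> g a <= u -> v <= g b ->
    dyadic_PL (f \o g) (q u) (q v).
  apply: dyadic_PL_ind => [u|u v w j uv dv fE _ vw IH gau wgb].
    by move=> *; exact: dyadic_PL_nil.
  have vgb := le_trans vw wgb.
  have gav := le_trans gau (ltW uv).
  have ugb := le_trans (ltW uv) vgb.
  have [aqu qub gqu] := gq u gau ugb.
  have [aqv qvb gqv] := gq v gav vgb.
  apply: (@dyadic_PL_cons _ (q u) (q v) (q w) (j + k)).
  + by rewrite /q ltrD2l ltr_pM2l ?exprz_gt0 // ltrD2r.
  + exact: dq.
  + move=> x /andP[qux xqv] /=; rewrite gqu.
    have ax := le_trans aqu qux; have xb := le_trans xqv qvb.
    have gx : g x = u + 2 ^ k * (x - q u).
      rewrite (gE x) ?ax ?xb // -{1}gqu (gE (q u)) ?aqu ?qub //.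
      by ring.
    rewrite gx fE; last first.
      rewrite lerDl mulr_ge0 ?(ltW k0) ?subr_ge0 //=.
      have <- : u + 2 ^ k * (q v - q u) = v.
        rewrite /q; transitivity (u + (2 ^ k * 2 ^ (- k)) * (v - u)); first by ring.
        by rewrite kK mul1r addrC subrK.
      by rewrite lerD2l ler_pM2l // lerD2r.
    by rewrite expfzDr ?pnatr_eq0 //; ring.
  + exact: IH.
have := H _ _ PL (lexx _) (lexx _); rewrite qgb.
by rewrite {1}/q subrr mulr0 addr0.
Qed.

Lemma affine_dyadic g a b (k : int) : a <= b -> dyadic a -> dyadic (g a) ->
  dyadic b -> (forall x, a <= x <= b -> g x = g a + 2 ^ k * (x - a)) ->
  dyadic (g b).
Proof.
move=> ab da dga db gE; rewrite gE ?ab ?lexx //.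
by apply: dyadicD => //; apply/dyadicZ/dyadicD => //; exact: dyadicN.
Qed.

Lemma dyadic_PL_comp f g a c : {homo g : x y / x < y} ->
  dyadic a -> dyadic (g a) ->
  dyadic_PL g a c -> dyadic_PL f (g a) (g c) -> dyadic_PL (f \o g) a c.
Proof.
move=> gi + + PL; move: a c PL; apply: dyadic_PL_ind => [a *|].
  exact: dyadic_PL_nil.
move=> a b c k ab db gE _ bc IH da dga PLf.
have dgb : dyadic (g b) by apply: affine_dyadic gE => //; exact: ltW.
have gbc : g b <= g c by move: bc; rewrite le_eqVlt => /predU1P[->|/gi/ltW].
have [P1 P2] := dyadic_PL_split PLf dgb (introT andP (conj (ltW (gi _ _ ab)) gbc)).
apply: (@dyadic_PL_cat _ a b); last exact: IH.
exact: affine_comp gE _ _ _.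
Qed.

Lemma dyadic_PL_inv f g a c : {homo g : x y / x < y} ->
  cancel g f -> cancel f g -> dyadic a -> dyadic (g a) ->
  dyadic_PL g a c -> dyadic_PL f (g a) (g c).
Proof.
move=> gi gK fK + + PL.
have gl : {mono g : x y / x <= y} by apply: le_mono.
move: a c PL; apply: dyadic_PL_ind => [a *|].
  exact: dyadic_PL_nil.
move=> a b c k ab db gE _ bc IH da dga.
have dgb : dyadic (g b) by apply: affine_dyadic gE => //; exact: ltW.
apply: (@dyadic_PL_cons _ _ (g b) _ (- k)) => //; [exact: gi| |exact: IH].
move=> y; rewrite -{1 2}(fK y) !gl gK => /andP[ay yb].
have kK : (2 : R) ^ (- k) * 2 ^ k = 1.
  by rewrite -invr_expz mulVf // expfz_neq0 // pnatr_eq0.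
rewrite -{2}(fK y) (gE (f y)) ?ay ?yb //.
transitivity (a + (2 ^ (- k) * 2 ^ k) * (f y - a)); last by ring.
by rewrite kK mul1r addrC subrK.
Qed.

Lemma is_thompsonFP (h : circle R -> circle R) : is_thompsonF h <->
  exists g, [/\ increasing_lift h g, g 0 = 0 & dyadic_PL g 0 1].
Proof.
split=> [[_ h0 [g [gc gi g1 gh] PL]]|[g [[gc gi g1 gh] g0 PL]]]; last first.
  by split; [exists g|rewrite -gh g0|exists g].
have /circle_piP : circle_pi (g 0) = circle_pi 0 by rewrite gh.
rewrite subr0 => /intrP[m gm].
exists (fun x => g x - m%:~R); split; last first.
- case: PL => s ls ps; exists s => //; move: ps {ls}; move: 0 => a.
  elim: s a => //= b s IH a [ab db [k gE] ps]; split => //; last exact: IH.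
  by exists k => x /gE ->; ring.
- by rewrite gm subrr.
split.
- by move=> x; apply: cvgB; [exact: gc|exact: cvg_cst].
- by move=> x y xy; rewrite ltrD2r gi.
- by move=> x; rewrite g1; ring.
- move=> x; rewrite -gh; apply/circle_piP.
  have -> : g x - m%:~R - g x = (- m)%:~R by rewrite rmorphN /=; ring.
  exact: intr_int.
Qed.

Lemma lift_natD (g : R -> R) : (forall x, g (x + 1) = g x + 1) ->
  forall x (n : nat), g (x + n%:R) = g x + n%:R.
Proof.
move=> g1 x; elim=> [|n IH]; first by rewrite !addr0.
by rewrite -natr1 !addrA g1 IH.
Qed.

Lemma lift_surj (g : R -> R) : continuous g -> (forall x, g (x + 1) = g x + 1) ->
  forall y, exists x, g x = y.
Proof.
move=> gc g1 y.
pose n := Num.bound `|y - g 0|.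
have yn : `|y - g 0| < n%:R by apply: archi_boundP; exact: normr_ge0.
have gn : g n%:R = g 0 + n%:R by rewrite -(lift_natD g1) add0r.
have gNn : g (- n%:R) = g 0 - n%:R.
  by apply: (addIr n%:R); rewrite -(lift_natD g1) subrK addNr.
have n0 : (0 : R) <= n%:R by rewrite ler0n.
have [|||x _ gx] := @IVT R g (- n%:R) n%:R y; last by exists x.
- by lra.
- exact: continuous_subspaceT.
- move: yn; rewrite ltr_norml gn gNn => /andP[h1 h2].
  by rewrite ge_min le_max; apply/andP; split; apply/orP; [left|right]; lra.
Qed.

Fact thompsonF1 : 1%g \in thompsonF.
Proof.
rewrite inE; apply/is_thompsonFP; exists idfun; split => //.
  by split => // x; exact: cvg_id.
apply: (@dyadic_PL_cons _ 0 1 1 0) => //; first exact: (dyadic_int 1).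
  by move=> x _ /=; rewrite expr0z; ring.
exact: dyadic_PL_nil.
Qed.

Fact thompsonFM : mulg_closed thompsonF.
Proof.
move=> h1 h2; rewrite !inE => /is_thompsonFP[g1 [[c1 i1 p1 l1] z1 P1]].
move=> /is_thompsonFP[g2 [[c2 i2 p2 l2] z2 P2]].
apply/is_thompsonFP; exists (g1 \o g2); split; last first.
- apply: dyadic_PL_comp => //; rewrite ?z2; try exact: (dyadic_int 0).
  by rewrite -[X in g2 X]add0r p2 z2 add0r.
- by rewrite /= z2.
split.
- by move=> x; apply: continuous_comp; [exact: c2|exact: c1].
- by move=> x y /i2/i1.
- by move=> x /=; rewrite p2 p1.
- by move=> x /=; rewrite l1 l2.
Qed.

Fact thompsonFV : invg_closed thompsonF.
Proof.
move=> h; rewrite !inE => /is_thompsonFP[g [[gc gi g1 gh] g0 PL]].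
have [f fK] : {f : R -> R & cancel f g}.
  have /choice[f fK] := lift_surj gc g1.
  by apply: cid; exists f.
have gI : {mono g : x y / x <= y} by apply: le_mono.
have gL : {mono g : x y / x < y} by apply: leW_mono.
have gK : cancel g f by move=> x; apply: (inc_inj gI); rewrite fK.
apply/is_thompsonFP; exists f; split; last first.
- have := dyadic_PL_inv gi gK fK (dyadic_int 0) _ PL.
  rewrite g0; have -> : g 1 = 1 by rewrite -[X in g X]add0r g1 g0 add0r.
  by apply; exact: (dyadic_int 0).
- by rewrite -[X in f X]g0 gK.
split.
- move=> y; apply/cvgrPdist_lt => e e0.
  have h1 : g (f y - e) < y by rewrite -[ltRHS]fK gL; lra.
  have h2 : y < g (f y + e) by rewrite -[ltLHS]fK gL; lra.
  near=> z.
  have : g (f y - e) < z by near: z; exact: lt_nbhsr.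
  have : z < g (f y + e) by near: z; exact: lt_nbhsl.
  by rewrite -{1 2}(fK z) !gL distrC ltr_distl => -> ->.
- by move=> x y xy; rewrite -gL !fK.
- by move=> x; apply: (inc_inj gI); rewrite fK g1 fK.
- by move=> x; rewrite -[in RHS](fK x) gh /= homeoK.
Unshelve. all: by end_near. Qed.

HB.instance Definition _ :=
  isMulClosed.Build (homeo (circle R)) thompsonF thompsonFM.
HB.instance Definition _ :=
  isMul1Closed.Build (homeo (circle R)) thompsonF thompsonF1.
HB.instance Definition _ :=
  isInvClosed.Build (homeo (circle R)) thompsonF thompsonFV.

End ThompsonF.

Arguments thompsonF R : clear implicits.

(* Amenability of a discrete group: existence of a finitely additive, left
   invariant probability measure defined on all its subsets. *)
Section Amenable.
Variables (R : realType) (G : groupType).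

Definition amenable : Prop :=
  exists mu : set G -> R,
    [/\ forall A, 0 <= mu A,
        mu [set: G] = 1,
        forall A B, A `&` B = set0 -> mu (A `|` B) = mu A + mu B &
        forall (g : G) A, mu [set (g * x)%g | x in A] = mu A].

End Amenable.

Section L2.
Variables (R : realType) (X : choiceType).
Local Notation C := R[i].

Definition sqnorm (xi : X -> C) : \bar R :=
  \esum_(x in [set: X]) (Normc.normc (xi x) ^+ 2)%:E.

Definition square_summable : {pred X -> C} :=
  [pred xi | (sqnorm xi < +oo)%E].

Lemma square_summable_closed : submod_closed square_summable.
Proof.
split=> [|a u v]; rewrite !inE /sqnorm.
  by rewrite esum1 ?ltry// => x _; rewrite Normc.normc0 expr0n.
move=> hu hv; pose k : R := Normc.normc a ^+ 2.
have k0 : 0 <= k by rewrite sqr_ge0.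
have h (w : X -> C) x : (0 <= (Normc.normc (w x) ^+ 2)%:E)%E.
  by rewrite lee_fin sqr_ge0.
have fin (w : X -> C) : (\esum_(x in [set: X]) (Normc.normc (w x) ^+ 2)%:E < +oo)%E ->
    exists2 M : R, 0 <= M & forall s : seq X, uniq s ->
      \sum_(x <- s) Normc.normc (w x) ^+ 2 <= M.
  move=> hw; exists (fine (\esum_(x in [set: X]) (Normc.normc (w x) ^+ 2)%:E)).
    by apply: fine_ge0; apply: esum_ge0.
  move=> s us; rewrite -lee_fin fineK; last first.
    by rewrite ge0_fin_numE //; apply: esum_ge0.
  rewrite -sumEFin; apply: esum_ge; exists [set` s]; first by split.
  by rewrite [leLHS]fsbig_seq.
have [M M0 hM] := fin _ hu; have [N N0 hN] := fin _ hv.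
apply: (@le_lt_trans _ _ (2 * k * M + 2 * N)%:E); last exact: ltry.
apply: ge_ereal_sup => _ [F [fF _] <-].
rewrite fsbig_finite //= sumEFin lee_fin.
have := finmap.fset_uniq (fset_set F); move: (finmap.enum_fset _) => s us.
apply: (@le_trans _ _ (\sum_(x <- s)
    (2 * k * Normc.normc (u x) ^+ 2 + 2 * Normc.normc (v x) ^+ 2))).
  apply: ler_sum => x _.
  have h1 : Normc.normc (a * u x + v x) <=
      Normc.normc a * Normc.normc (u x) + Normc.normc (v x).
    by rewrite -Normc.normcM; exact: le_normcD.
  have p (z : C) : 0 <= Normc.normc z by case: z => z1 z2 /=; rewrite sqrtr_ge0.
  apply: (@le_trans _ _ ((Normc.normc a * Normc.normc (u x) + Normc.normc (v x)) ^+ 2)).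
    by rewrite lerXn2r ?nnegrE ?addr_ge0 ?mulr_ge0 //; exact: p.
  rewrite /k -subr_ge0.
  have := sqr_ge0 (Normc.normc a * Normc.normc (u x) - Normc.normc (v x)).
  by move=> h2; apply: le_trans h2 _; rewrite le_eqVlt; apply/orP; left; apply/eqP; ring.
rewrite big_split /= -!mulr_sumr; apply: lerD; apply: ler_wpM2l => //.
- by rewrite mulr_ge0.
- exact: hM.
- exact: hN.
Qed.

HB.instance Definition _ :=
  GRing.isSubmodClosed.Build C (X -> C) square_summable square_summable_closed.

Definition l2 : Type := {xi : X -> C | xi \in square_summable}.

HB.instance Definition _ := SubChoice.on l2.
HB.instance Definition _ := [SubChoice_isSubLmodule of l2 by <:].

Definition l2norm (xi : l2) : R := Num.sqrt (fine (sqnorm (val xi))).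

End L2.

Section Operators.
Variables (R : realType) (X : choiceType).
Local Notation H := (l2 R X).
Implicit Types (S T : H -> H) (A J : set (H -> H)).

(* Operators are represented by their underlying functions. *)
Definition opnorm_le T (c : R) : Prop :=
  forall xi, l2norm (T xi) <= c * l2norm xi.

Definition bounded_operator T : Prop :=
  linear T /\ exists c, opnorm_le T c.

Definition opnorm_closure A : set (H -> H) :=
  [set T | bounded_operator T /\
    forall e, 0 < e -> exists2 S, A S & opnorm_le (T - S) e].

Definition closed_ideal A J : Prop :=
  [/\ [/\ J `<=` A, J 0, forall S T, J S -> J T -> J (S + T) &
        forall (a : R[i]) T, J T -> J (a *: T)],
      forall S T, A S -> J T -> J (S \o T) /\ J (T \o S) &
      opnorm_closure J `<=` J].

Definition simple_algebra A : Prop :=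
  A <> [set 0] /\
  forall J, closed_ideal A J -> J = [set 0] \/ J = A.

End Operators.

Section ReducedCStarAlgebra.
Variables (R : realType) (G : groupType).

Lemma left_translate_l2 (g : G) (xi : l2 R G) :
  (fun x => val xi (g^-1 * x)%g) \in @square_summable R G.
Proof.
rewrite inE /sqnorm.
rewrite -(@reindex_esum R G G setT setT (fun x => (g^-1 * x)%g)
  (fun x => (Normc.normc (val xi x) ^+ 2)%:E)); first exact: (valP xi).
split=> //.
- by move=> x y _ _ /mulgI.
- by move=> y _; exists (g * y)%g => //; rewrite mulKg.
Qed.

Definition left_regular (g : G) (xi : l2 R G) : l2 R G :=
  exist (fun f => f \in @square_summable R G) _ (left_translate_l2 g xi).

Definition group_algebra_image : set (l2 R G -> l2 R G) :=
  [set T | exists s : seq (R[i] * G),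
    T = \sum_(p <- s) p.1 *: left_regular p.2].

Definition reduced_cstar_algebra : set (l2 R G -> l2 R G) :=
  opnorm_closure group_algebra_image.

Definition cstar_simple : Prop := simple_algebra reduced_cstar_algebra.

End ReducedCStarAlgebra.

(* Main.v *)
Require Import Defs.
From HB Require Import structures.
From mathcomp Require Import all_boot all_order all_algebra.
From mathcomp Require Import generic_quotient complex ring lra.
From mathcomp Require Import all_classical all_reals all_analysis.

(** Let [lambda] be the left regular representation.  The reduced C*-algebra of
    [G] is simple as soon as Powers' averaging property holds
    ([powers_averaging]): for finitely many [t <> 1] in [G] and [e > 0], one
    finite average of conjugations by elements of [G] brings all the
    [lambda t] to norm at most [e].  Indeed a nonzero closed ideal contains an
    operator whose coefficient at the identity is 1; approximating it by a
    finite combination of the [lambda t] and averaging, the terms with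
    [t <> 1] become negligible, so the ideal comes arbitrarily close to the
    identity operator, hence contains it ([powers_averaging_simple]).

    The averages come from non-amenability of [F] and from the copies of [F]
    that live in small arcs.  Suppose that [t] displaces an arc [U], i.e., that
    [t U] and [U] are disjoint, and let [iota : F -> G] be a copy of [F]
    supported in [U].  Then [iota F] and its conjugate by [t] commute and meet
    trivially.  Up to [lambda t], the average of the [lambda (s t s^-1)] is an
    average of translations by the products [s (t s^-1 t^-1)].  All
    coefficients are nonnegative, so replacing a function by the roots of the
    sums of its squares along the cosets of [t (iota F) t^-1] shows that its
    norm is at most that of the average of the translations by [s] on the
    square-summable functions over [F] ([contracts_fibred],
    [opnorm_conj_average_morph]).  By the theorem of Kesten and Day, some such
    average has norm below 1 because [F] is not amenable, and its powers have
    norms tending to 0 ([nonamenable_contracts_small]).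

    For several elements [t_i], choose pairwise disjoint dyadic arcs [U_i] with
    [U_i] displaced by [t_i] ([displaced_arcs]) and average in all these arcs
    in turn.  An element supported off [U_i] conjugates [t_i] to an element
    which still displaces [U_i], and the bound obtained in [U_i] is the same
    for all such elements; so the averages in the other arcs do no harm
    ([averaging_domains]).

    The copy of [F] in the arc from [j/N] to [(j+1)/N] has an explicit formula.
    If [g] is the lift of an element of [F] that fixes 0, then [g] commutes with
    integer translations, and its copy is [x |-> g (N x) / N] on the points [x]
    whose image lies in the arc and the identity elsewhere ([arc_lift]). *)

Set Implicit Arguments.
Unset Strict Implicit.
Unset Printing Implicit Defensive.

Import Order.TTheory GRing.Theory Num.Theory.
Import numFieldNormedType.Exports.

Local Open Scope classical_set_scope.
Local Open Scope ring_scope.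
Local Open Scope quotient_scope.

(** * Finite sums of squares *)

Section FiniteSums.
Variable R : realType.

Lemma sum_sqr_ge0 (I : Type) (r : seq I) (P : pred I) (a : I -> R) :
  0 <= \sum_(i <- r | P i) a i ^+ 2.
Proof. by apply: sumr_ge0 => i _; exact: sqr_ge0. Qed.

Lemma sum_cauchy_schwarz (I : Type) (r : seq I) (P : pred I) (a b : I -> R) :
  (\sum_(i <- r | P i) a i * b i) ^+ 2 <=
  (\sum_(i <- r | P i) a i ^+ 2) * (\sum_(i <- r | P i) b i ^+ 2).
Proof.
set A := \sum_(i <- r | P i) a i ^+ 2; set B := \sum_(i <- r | P i) b i ^+ 2.
set C := \sum_(i <- r | P i) a i * b i.
have A0 : 0 <= A := sum_sqr_ge0 _ _ _.
have B0 : 0 <= B := sum_sqr_ge0 _ _ _.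
(* The quadratic form of the pair of vectors; its value at [(B, C)] yields the
   inequality when [B] is positive. *)
have quad (u v : R) : 0 <= u ^+ 2 * A - 2 * u * v * C + v ^+ 2 * B.
  suff -> : u ^+ 2 * A - 2 * u * v * C + v ^+ 2 * B =
    \sum_(i <- r | P i) (u * a i - v * b i) ^+ 2 by exact: sum_sqr_ge0.
  rewrite /A /B /C !mulr_sumr -sumrB -big_split /=.
  by apply: eq_bigr => i _; ring.
move: B0; rewrite le_eqVlt => /predU1P[B0|B0].
  (* If [B = 0], positivity of the form along [(C, A + 1)] forces [C = 0]. *)
  have := quad C (A + 1); rewrite -B0 mulr0.
  have := sqr_ge0 C => /=; nra.
have := quad B C; rewrite -(ler_pM2l B0) mulr0 => h.
by rewrite -(ler_pM2l B0); nra.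
Qed.

(** Minkowski's inequality for finitely many vectors, in squared form: it bounds
    the norm along a fibre of a sum of translates. *)
Lemma sum_minkowski (I J : Type) (r : seq I) (s : seq J) (P : pred I)
    (a : J -> I -> R) :
  \sum_(i <- r | P i) (\sum_(j <- s) a j i) ^+ 2 <=
  (\sum_(j <- s) Num.sqrt (\sum_(i <- r | P i) a j i ^+ 2)) ^+ 2.
Proof.
elim: s => [|j s IH].
  by rewrite big_nil big1 ?expr0n //= => i _; rewrite big_nil expr0n.
rewrite big_cons.
set A := \sum_(i <- r | P i) a j i ^+ 2.
set b := fun i => \sum_(j <- s) a j i.
set B := \sum_(i <- r | P i) b i ^+ 2.
set T := \sum_(j <- s) _ in IH *.
have A0 : 0 <= A := sum_sqr_ge0 _ _ _.
have T0 : 0 <= T by apply: sumr_ge0 => i _; exact: sqrtr_ge0.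
have {}IH : B <= T ^+ 2 := IH.
have -> : \sum_(i <- r | P i) (\sum_(k <- j :: s) a k i) ^+ 2 =
    A + 2 * (\sum_(i <- r | P i) a j i * b i) + B.
  rewrite /A /B mulr_sumr -!big_split /=; apply: eq_bigr => i _.
  by rewrite big_cons -/(b i); ring.
set C := \sum_(i <- r | P i) a j i * b i.
have CAB : C <= Num.sqrt A * T.
  have := sum_cauchy_schwarz r P (a j) b; rewrite -/A -/B -/C => CAB.
  rewrite -[T]ger0_norm // -sqrtr_sqr -sqrtrM //.
  rewrite (le_trans (ler_norm _)) // -sqrtr_sqr ler_wsqrtr //.
  by rewrite (le_trans CAB) // ler_wpM2l.
by rewrite sqrrD sqr_sqrtr //; lra.
Qed.

Lemma ler_sum_subset (I : eqType) (r s : seq I) (a : I -> R) :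
  (forall i, 0 <= a i) -> uniq r -> {subset r <= s} ->
  \sum_(i <- r) a i <= \sum_(i <- s) a i.
Proof.
move=> a0; elim: r s => [|i r IH] s /=; first by rewrite big_nil sumr_ge0.
move=> /andP[ir ur] rs; rewrite big_cons.
have is_ : i \in s by apply: rs; rewrite mem_head.
rewrite (perm_big _ (perm_to_rem is_)) big_cons lerD2l IH // => j jr.
have : j \in s by apply: rs; rewrite in_cons jr orbT.
rewrite (perm_mem (perm_to_rem is_)) in_cons => /predU1P[ji|//].
by rewrite -ji jr in ir.
Qed.

(** With a range containing the translated supports, finite sums can be reindexed
    by translations. *)
Lemma sum_support (I : eqType) (r D : seq I) (a : I -> R) :
  uniq r -> uniq D -> {subset D <= r} -> (forall i, i \notin D -> a i = 0) ->
  \sum_(i <- r) a i = \sum_(i <- D) a i.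
Proof.
move=> ur uD Dr a0; rewrite (bigID (fun i => i \in D)) /=.
rewrite [X in _ + X]big1 ?addr0; last by move=> i; exact: a0.
rewrite -big_filter; apply: perm_big; apply: uniq_perm => //.
  exact: filter_uniq.
move=> i; rewrite mem_filter; case: (boolP (i \in D)) => //= iD.
by rewrite Dr.
Qed.

Lemma sum_fibers (V : nmodType) (I J : eqType) (p : I -> J) (r : seq I)
    (s : seq J) (a : I -> V) : uniq s ->
  \sum_(j <- s) \sum_(i <- r | p i == j) a i =
  \sum_(i <- r | p i \in s) a i.
Proof.
move=> us.
rewrite (exchange_big_dep xpredT) //= [RHS]big_mkcond; apply: eq_bigr => i _.
under eq_bigl do rewrite eq_sym.
case: ifPn => pis; first by rewrite -big_filter filter_pred1_uniq // big_seq1.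
rewrite big_seq_cond big1 // => j /andP[js /eqP jE].
by rewrite -jE js in pis.
Qed.

Lemma sum_const_seq (I : Type) (r : seq I) (c : R) :
  \sum_(i <- r) c = (size r)%:R * c.
Proof. by rewrite big_const_seq count_predT iter_addr_0 mulr_natl. Qed.

(** The parallelogram identity behind Day's argument: if the average of vectors
    of equal norm almost keeps that norm, the vectors almost coincide. *)
Lemma sum_sqr_diff (I : Type) (r : seq I) (a : I -> R) :
  \sum_(i <- r) \sum_(j <- r) (a i - a j) ^+ 2 =
  2 * (size r)%:R * (\sum_(i <- r) a i ^+ 2) - 2 * (\sum_(i <- r) a i) ^+ 2.
Proof.
have E i : \sum_(j <- r) (a i - a j) ^+ 2 =
    (size r)%:R * a i ^+ 2 - 2 * a i * (\sum_(j <- r) a j) +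
    \sum_(j <- r) a j ^+ 2.
  rewrite -sum_const_seq mulr_sumr -sumrB -big_split /=.
  by apply: eq_bigr => j _; ring.
under eq_bigr do rewrite E.
rewrite big_split sumrB /= sum_const_seq -mulr_sumr -mulr_suml -mulr_sumr.
by ring.
Qed.

End FiniteSums.

Section SquareBound.
Variable R : realType.

(** Quantifying over finite lists avoids infinite sums and lets [f] be
    arbitrary. *)
Definition sqbound (X : eqType) (f : X -> R) (M : R) : Prop :=
  forall E : seq X, uniq E -> \sum_(x <- E) f x ^+ 2 <= M.

(** [C] bounds the squared operator norm of the sum of the translations by [S],
    counted with multiplicity; this sum has nonnegative coefficients, so its
    values on nonnegative functions determine its norm.  For the average over
    [S], divide [C] by the square of the length of [S]. *)
Definition contracts (Gam : groupType) (S : seq Gam) (C : R) : Prop :=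
  forall f M, (forall x, 0 <= f x) -> sqbound f M ->
    sqbound (fun x => \sum_(s <- S) f (s^-1 * x)%g) (C * M).

Lemma contracts1 (Gam : groupType) : contracts [:: 1%g : Gam] 1.
Proof.
move=> f M _ fM E /fM; rewrite mul1r; apply: le_trans.
by rewrite le_eqVlt; apply/orP; left; apply/eqP; apply: eq_bigr => x _;
  rewrite big_seq1 invg1 mul1g.
Qed.

(** The sum of the translations by the products [s * t] is the composite of the
    two sums of translations. *)
Lemma contractsM (Gam : groupType) (S T : seq Gam) (C D : R) :
  contracts S C -> contracts T D ->
  contracts [seq (s * t)%g | s <- S, t <- T] (C * D).
Proof.
move=> cS cT f M f0 fM.
have := cS _ _ _ (cT _ _ f0 fM); rewrite mulrA => h E uE.
apply: le_trans (h _ E uE); last by move=> x; exact: sumr_ge0.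
rewrite le_eqVlt; apply/orP; left; apply/eqP; apply: eq_bigr => x _.
rewrite big_allpairs_dep; congr (_ ^+ 2); apply: eq_bigr => s _.
by apply: eq_bigr => t _; rewrite invgM mulgA.
Qed.

(** Bounds for translations on a group carry over to a set [X] lying above it.
    Replace [f] by its norms [F g] along the fibres of [theta].  The maps
    [sigma s] cover the translations, so Minkowski's inequality in each fibre
    bounds the sum over [X] by the one for [F] over the group.  In the
    application the [sigma s] are not multiplicative in [s], which is why powers
    of an average have to be estimated on the group first. *)
Lemma contracts_fibred (Gam : groupType) (X : eqType) (theta : X -> Gam)
    (S : seq Gam) (C : R) (sigma : Gam -> X -> X) :
  (forall s, injective (sigma s)) ->
  (forall s x, theta (sigma s x) = (s^-1 * theta x)%g) ->
  contracts S C ->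
  forall f M, (forall x, 0 <= f x) -> sqbound f M ->
    sqbound (fun x => \sum_(s <- S) f (sigma s x)) (C * M).
Proof.
move=> sI thetaE cS f M f0 fM E uE.
(* Only the values of [f] at these points occur in the sum, so the fibre norms
   may be computed on the finite set [D]. *)
pose D := undup [seq sigma s x | s <- S, x <- E].
pose F g := Num.sqrt (\sum_(x <- D | theta x == g) f x ^+ 2).
have FM : sqbound F M.
  move=> E' uE'; apply: le_trans (fM D (undup_uniq _)).
  under eq_bigr do rewrite sqr_sqrtr ?sum_sqr_ge0 //.
  rewrite sum_fibers // [leRHS](bigID (fun x => theta x \in E')) /=.
  by rewrite lerDl sum_sqr_ge0.
pose U := undup (map theta E).
apply: le_trans (cS F M _ FM U (undup_uniq _)); last first.
  by move=> g; exact: sqrtr_ge0.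
have -> : \sum_(x <- E) (\sum_(s <- S) f (sigma s x)) ^+ 2 =
    \sum_(g <- U) \sum_(x <- E | theta x == g)
      (\sum_(s <- S) f (sigma s x)) ^+ 2.
  rewrite sum_fibers ?undup_uniq // big_seq [RHS]big_seq_cond.
  apply: eq_bigl => x; case: (boolP (x \in E)) => //= xE.
  by rewrite mem_undup map_f.
apply: ler_sum => g _; apply: le_trans (sum_minkowski _ _ _ _) _.
rewrite ler_sqr ?nnegrE; try by apply: sumr_ge0 => s _; exact: sqrtr_ge0.
rewrite big_seq [leRHS]big_seq; apply: ler_sum => s sS; apply: ler_wsqrtr.
rewrite -big_filter -(big_map (sigma s) xpredT (fun y => f y ^+ 2)).
rewrite -[leRHS]big_filter; apply: ler_sum_subset => [x||y].
- exact: sqr_ge0.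
- by rewrite (map_inj_uniq (@sI s)) filter_uniq.
move=> /mapP[x]; rewrite mem_filter => /andP[/eqP xg xE] ->.
rewrite mem_filter thetaE xg eqxx mem_undup.
by apply/allpairsP; exists (s, x).
Qed.

End SquareBound.

(** * Invariant means as limits of almost invariant means *)

Section Means.
Variable R : realType.

Definition additive_mean (X : Type) (m : set X -> R) : Prop :=
  [/\ forall A, 0 <= m A, m setT = 1 &
      forall A B, A `&` B = set0 -> m (A `|` B) = m A + m B].

Lemma additive_mean_le1 (X : Type) (m : set X -> R) A :
  additive_mean m -> m A <= 1.
Proof.
move=> [m0 m1 mD]; have := mD A (~` A) (setICr A).
by rewrite setUCr m1 => ->; rewrite lerDl m0.
Qed.

(** The filter decides every preimage; if it contains the complement of the
    preimage of [A], no proper filter above the image contains [A]. *)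
Lemma ultra_fmap (X Y : Type) (f : X -> Y) (F : set_system X) :
  UltraFilter F -> UltraFilter (f @ F).
Proof.
move=> FU; split=> [|G PG FG]; first exact: fmap_proper_filter.
apply/seteqP; split=> // A GA.
have [//|FnA] := in_ultra_setVsetC (f @^-1` A) FU.
have : G (A `&` ~` A) by apply: filterI => //; exact: FG.
by rewrite setICr => /filter_not_empty.
Qed.

(** Compactness: the means that are [1/(k+1)]-invariant under a finite list, for
    all lists and all [k], form a filter base; along an ultrafilter refining it,
    the values of the means at each set converge, and the limit is an invariant
    mean. *)
Lemma almost_invariant_amenable (Gam : groupType) :
  (forall (S : seq Gam) (e : R), 0 < e -> exists2 m : set Gam -> R, additive_mean m &
    forall s (A : set Gam), s \in S -> `|m [set (s * x)%g | x in A] - m A| <= e) ->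
  amenable R Gam.
Proof.
move=> ai.
pose B (i : seq Gam * nat) : set (set Gam -> R) := [set m | additive_mean m /\
  forall s (A : set Gam), s \in i.1 ->
    `|m [set (s * x)%g | x in A] - m A| <= i.2.+1%:R^-1].
pose F := filter_from [set: seq Gam * nat] B.
have FF : ProperFilter F.
  apply: filter_from_proper.
    apply: filter_from_filter => [|[S k] [T l] _ _]; first by exists ([::], 0).
    exists (S ++ T, maxn k l) => // m [mm mi]; split; (split=> //) => s A sS.
      apply: le_trans (mi s A _) _; first by rewrite mem_cat sS.
      by rewrite lef_pV2 ?posrE ?ltr0n // ler_nat ltnS leq_maxl.
    apply: le_trans (mi s A _) _; first by rewrite mem_cat sS orbT.
    by rewrite lef_pV2 ?posrE ?ltr0n // ler_nat ltnS leq_maxr.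
  move=> [S k] _; have [|m mm mi] := ai S k.+1%:R^-1.
    by rewrite invr_gt0 ltr0n.
  by exists m.
have [U [UU FU]] := ultraFilterLemma FF.
have Umean : U (@additive_mean Gam) by apply: FU; exists ([::], 0) => // m [].
have lim_ex A : exists l : R, (fun m : set Gam -> R => m A) @ U --> l.
  have := @segment_compact R 0 1; rewrite compact_ultra.
  move=> /(_ ((fun m : set Gam -> R => m A) @ U) (ultra_fmap _ UU)).
  case=> [|l [_ Ul]]; last by exists l.
  apply: (@filterS _ U _ (@additive_mean Gam) _ _ Umean) => m mm /=.
  have m1 := additive_mean_le1 A mm.
  by rewrite in_itv /= m1 andbT; case: mm.
have /choice[mu muE] := lim_ex.
have PU : ProperFilter U by case: UU.
have limE (f : (set Gam -> R) -> R) (l l' : R) :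
    f @ U --> l -> f @ U --> l' -> l = l' by apply: cvg_unique.
have Umean' (P : set (set Gam -> R)) : @additive_mean Gam `<=` P -> U P.
  by move=> sP; exact: filterS Umean.
exists mu; split.
- move=> A; apply: (closed_cvg (fun x : R => 0 <= x) _ _ _ (muE A)).
    exact: closed_ge.
  by apply: Umean' => m [].
- apply: (limE _ _ _ (muE setT)).
  by apply: cvg_near_cst; apply: Umean' => m [].
- move=> A C AC; apply: (limE _ _ _ (muE (A `|` C))).
  apply: cvg_trans (cvgD (muE A) (muE C)).
  by apply: near_eq_cvg; apply: Umean' => m [_ _ mD] /=; rewrite mD.
- move=> g A; apply/eqP; rewrite -subr_eq0; apply/eqP.
  apply: (limE _ _ _ (cvgB (muE [set (g * x)%g | x in A]) (muE A))).
  apply/cvgrPdist_le => e e0.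
  pose i := ([:: g], Num.truncn e^-1).
  have : U (B i) by apply: FU; exists i.
  apply: filterS => m [_ /(_ g A)]; rewrite mem_head => /(_ isT) h.
  rewrite sub0r normrN; apply: le_trans h _.
  by rewrite invf_ple ?posrE ?ltr0n // ltW // truncnS_gt.
Qed.

End Means.

(** * Contracting averages on a non-amenable group *)

Section KestenDay.
Variable R : realType.

(** The arithmetic-geometric mean inequality applied to the product of [b - a] and
    [a + b], with weights that trade a large constant on the small term for a
    small constant on the bounded one. *)
Lemma sqr_diff_le (a b e : R) : 0 < e ->
  `|a ^+ 2 - b ^+ 2| <= 2 / e * (b - a) ^+ 2 + e / 4 * (a ^+ 2 + b ^+ 2).
Proof.
move=> e0; have -> : `|a ^+ 2 - b ^+ 2| = `|e * (a ^+ 2 - b ^+ 2)| / e.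
  by rewrite normrM gtr0_norm // mulrAC divff ?mul1r // gt_eqF.
rewrite ler_pdivrMr // [leRHS]mulrC.
have -> : e * (2 / e * (b - a) ^+ 2 + e / 4 * (a ^+ 2 + b ^+ 2)) =
    2 * (b - a) ^+ 2 + e ^+ 2 / 4 * (a ^+ 2 + b ^+ 2).
  by field; rewrite gt_eqF.
have p1 := sqr_ge0 (2 * (a - b) + e / 2 * (a + b)).
have p2 := sqr_ge0 (2 * (a - b) - e / 2 * (a + b)).
have p3 := sqr_ge0 (e * (a - b)).
by rewrite ler_norml; apply/andP; split; lra.
Qed.

(** Day's argument: if averaging over [S] does not contract, some finitely
    supported [f] is almost fixed by the elements of [S], and the probability
    with density proportional to [f ^+ 2] is an almost invariant mean. *)
Lemma almost_invariant_mean (Gam : groupType) (S : seq Gam) (c e : R) :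
  1%g \in S -> 0 <= c -> 0 < e -> 8 * (size S)%:R ^+ 2 * (1 - c) <= e ^+ 2 ->
  ~ contracts S ((size S)%:R ^+ 2 * c) ->
  exists2 m : set Gam -> R, additive_mean m &
    forall s (A : set Gam), s \in S ->
      `|m [set (s * x)%g | x in A] - m A| <= e.
Proof.
set n := (size S)%:R => S1 c0 e0 ce ncS; apply: contrapT => nm.
apply: ncS => f M f0 fM E uE; rewrite leNgt; apply/negP => big; apply: nm.
pose D := undup [seq (s^-1 * x)%g | s <- S, x <- E].
have uD : uniq D by exact: undup_uniq.
(* [h] is [f] cut off to the points that contribute to the sum over [E], and [W]
   contains the supports of all its translates by [S]. *)
pose h x := if x \in D then f x else 0.
pose M' := \sum_(x <- D) f x ^+ 2.
pose W := undup (E ++ [seq (s * x)%g | s <- S, x <- D]).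
have uW : uniq W by exact: undup_uniq.
have hW s (g : Gam -> R) : s \in S ->
    \sum_(x <- W) g (s^-1 * x)%g * h (s^-1 * x)%g ^+ 2 =
    \sum_(x <- D) g x * f x ^+ 2.
  move=> sS; pose k x := g x * h x ^+ 2.
  rewrite -(big_map (fun x => s^-1 * x)%g xpredT k).
  rewrite (@sum_support _ _ _ D k) //.
  - by rewrite big_seq [RHS]big_seq; apply: eq_bigr => x xD; rewrite /k /h xD.
  - by rewrite map_inj_uniq //; exact: mulgI.
  - move=> x xD; apply/mapP; exists (s * x)%g; last by rewrite mulKg.
    by rewrite mem_undup mem_cat; apply/orP; right; apply/allpairsP; exists (s, x).
  - by move=> x /negbTE xD; rewrite /k /h xD expr0n mulr0.
have hW1 s : s \in S -> \sum_(x <- W) h (s^-1 * x)%g ^+ 2 = M'.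
  move=> sS; have := hW s (fun=> 1) sS.
  under eq_bigr do rewrite mul1r.
  by under [in X in _ = X -> _]eq_bigr do rewrite mul1r.
have hW2 : \sum_(x <- W) h x ^+ 2 = M'.
  by rewrite -(hW1 _ S1); apply: eq_bigr => x _; rewrite invg1 mul1g.
pose Q := \sum_(x <- W) (\sum_(s <- S) h (s^-1 * x)%g) ^+ 2.
have M'0 : 0 <= M' := sum_sqr_ge0 _ _ _.
have n0 : 0 <= n by rewrite ler0n.
have Qbig : n ^+ 2 * c * M' < Q.
  apply: (@le_lt_trans _ _ (n ^+ 2 * c * M)).
    by rewrite ler_wpM2l ?mulr_ge0 ?exprn_ge0 //; exact: fM.
  apply: (lt_le_trans big).
  apply: (@le_trans _ _ (\sum_(x <- E) (\sum_(s <- S) h (s^-1 * x)%g) ^+ 2)).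
    rewrite le_eqVlt; apply/orP; left; apply/eqP.
    rewrite big_seq [RHS]big_seq; apply: eq_bigr => x xE; congr (_ ^+ 2).
    rewrite big_seq [RHS]big_seq; apply: eq_bigr => s sS.
    rewrite /h mem_undup; case: ifPn => // /negP[].
    by apply/allpairsP; exists (s, x).
  apply: ler_sum_subset => // [x|x xE]; first exact: sqr_ge0.
  by rewrite mem_undup mem_cat xE.
have total : \sum_(x <- W) \sum_(i <- S) \sum_(j <- S)
    (h (i^-1 * x)%g - h (j^-1 * x)%g) ^+ 2 = 2 * n ^+ 2 * M' - 2 * Q.
  under eq_bigr do rewrite (sum_sqr_diff S).
  rewrite sumrB -!mulr_sumr -/Q exchange_big /= -/n; congr (_ - _).
  rewrite big_seq (eq_bigr (fun=> M')); last by move=> s; exact: hW1.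
  by rewrite -big_seq sum_const_seq -/n; ring.
have Qle : Q <= n ^+ 2 * M'.
  suff : 0 <= 2 * n ^+ 2 * M' - 2 * Q by lra.
  by rewrite -total; do 3 (apply: sumr_ge0 => ? _); exact: sqr_ge0.
have M'gt0 : 0 < M'.
  rewrite lt_neqAle M'0 andbT; apply/eqP => M'E.
  by move: Qbig Qle; rewrite -M'E !mulr0; lra.
have shift s : s \in S ->
    \sum_(x <- W) (h (s^-1 * x)%g - h x) ^+ 2 <= 2 * n ^+ 2 * (1 - c) * M'.
  move=> sS; apply: (@le_trans _ _ (2 * n ^+ 2 * M' - 2 * Q)); last by lra.
  rewrite -total; apply: ler_sum => x _.
  have term (F : Gam -> R) t : t \in S -> (forall u, 0 <= F u) ->
      F t <= \sum_(u <- S) F u.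
    move=> tS F0; rewrite -[leLHS](big_seq1 +%R); apply: ler_sum_subset => // u.
    by rewrite inE => /eqP ->.
  pose F i := \sum_(j <- S) (h (i^-1 * x)%g - h (j^-1 * x)%g) ^+ 2.
  apply: (@le_trans _ _ (F s)); last first.
    by apply: term => // i; exact: sum_sqr_ge0.
  have := @term (fun j => (h (s^-1 * x)%g - h (j^-1 * x)%g) ^+ 2) 1%g S1.
  by rewrite invg1 mul1g; apply=> j; exact: sqr_ge0.
pose m (A : set Gam) := (\sum_(x <- W) (x \in A)%:R * h x ^+ 2) / M'.
exists m; first split.
- move=> A; rewrite divr_ge0 //; apply: sumr_ge0 => x _.
  by rewrite mulr_ge0 ?sqr_ge0.
- rewrite /m (eq_bigr (fun x => h x ^+ 2)) ?hW2 ?divff ?gt_eqF // => x _.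
  by rewrite in_setT mul1r.
- move=> A B AB; rewrite /m -mulrDl -big_split /=; congr (_ / _).
  apply: eq_bigr => x _; rewrite -mulrDl -natrD; congr (_%:R * _).
  rewrite in_setU; case: (boolP (x \in A)) => // xA.
  case: (boolP (x \in B)) => // xB; exfalso.
  by suff: set0 x by []; rewrite -AB; split; apply/set_mem.
move=> s A sS.
have mA : m A = (\sum_(x <- W) (s^-1 * x \in A)%g%:R * h (s^-1 * x)%g ^+ 2) / M'.
  rewrite (hW s (fun x => (x \in A)%:R) sS) /m; congr (_ / _).
  rewrite -(hW _ (fun x => (x \in A)%:R) S1).
  by apply: eq_bigr => x _; rewrite invg1 mul1g.
have msA : m [set (s * x)%g | x in A] =
    (\sum_(x <- W) (s^-1 * x \in A)%g%:R * h x ^+ 2) / M'.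
  congr (_ / _); apply: eq_bigr => x _; congr (_%:R * _); congr nat_of_bool.
  apply/idP/idP => [/set_mem[y Ay <-]|/set_mem Ax]; apply/mem_set.
    by rewrite mulKg.
  by exists (s^-1 * x)%g => //; rewrite mulVKg.
rewrite mA msA -mulrBl -sumrB normrM (@gtr0_norm _ M'^-1) ?invr_gt0 //.
rewrite ler_pdivrMr //.
apply: (@le_trans _ _ (\sum_(x <- W) (2 / e * (h (s^-1 * x)%g - h x) ^+ 2 +
    e / 4 * (h x ^+ 2 + h (s^-1 * x)%g ^+ 2)))).
  apply: (le_trans (ler_norm_sum _ _ _)); apply: ler_sum => x _.
  rewrite -mulrBr; apply: le_trans (sqr_diff_le _ _ e0).
  by case: (_ \in A); rewrite ?mul1r // mul0r normr0.
rewrite big_split /= -!mulr_sumr big_split /= hW2 hW1 //.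
have : 2 / e * (\sum_(x <- W) (h (s^-1 * x)%g - h x) ^+ 2) <= e / 2 * M'.
  have e2 : 0 < 2 / e by rewrite divr_gt0.
  apply: (le_trans (ler_wpM2l (ltW e2) (shift _ sS))).
  rewrite -(ler_pM2l e0).
  have -> : e * (2 / e * (2 * n ^+ 2 * (1 - c) * M')) =
      (8 * n ^+ 2 * (1 - c)) * M' / 2 by field; rewrite gt_eqF.
  have := ler_wpM2r M'0 ce; lra.
by lra.
Qed.

(** One half of the Kesten-Day theorem: if no average contracted,
    [almost_invariant_mean] would provide almost invariant means for all finite
    lists. *)
Lemma nonamenable_contracts (Gam : groupType) : ~ amenable R Gam ->
  exists (S : seq Gam) (c : R), [/\ S != [::], 0 <= c, c < 1 &
    contracts S ((size S)%:R ^+ 2 * c)].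
Proof.
move=> na; apply: contrapT => nc; apply: na.
apply: almost_invariant_amenable => S e e0.
pose n : R := (size (1%g :: S))%:R.
have n0 : 0 < n by rewrite ltr0n.
have n2 : 0 < 8 * n ^+ 2 by rewrite mulr_gt0 ?exprn_gt0.
(* The identity is added to the list so that translates can be compared with the
   function itself; [c] is the smallest constant allowed by
   [almost_invariant_mean]. *)
pose c : R := Num.max 0 (1 - e ^+ 2 / (8 * n ^+ 2)).
have [|||||m mm mS] := @almost_invariant_mean _ (1%g :: S) c e.
- exact: mem_head.
- by rewrite le_max lexx.
- by [].
- rewrite -/n mulrC -ler_pdivlMr // lerBlDr addrC -lerBlDr.
  by rewrite le_max lexx orbT.
- move=> cS; apply: nc; exists (1%g :: S), c; split => //.
    by rewrite le_max lexx.
  by rewrite gt_max ltr01 /= ltrBlDr ltrDl divr_gt0 ?exprn_gt0.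
by exists m => // s A sS; apply: mS; rewrite in_cons sS orbT.
Qed.

(** The powers of a strictly contracting average are averages again, with norms
    tending to 0. *)
Lemma nonamenable_contracts_small (Gam : groupType) (e : R) :
  ~ amenable R Gam -> 0 < e ->
  exists2 S : seq Gam, S != [::] & contracts S ((e * (size S)%:R) ^+ 2).
Proof.
move=> na e0; have [S [c [S0 c0 c1 cS]]] := nonamenable_contracts na.
pose P k := iter k (fun T => [seq (s * t)%g | s <- S, t <- T]) [:: 1%g].
have sP k : size (P k) = (size S ^ k)%N.
  by elim: k => //= k IH; rewrite size_allpairs IH expnS.
have cP k : contracts (P k) (((size S)%:R ^+ 2 * c) ^+ k).
  elim: k => [|k IH]; first by rewrite expr0; exact: contracts1.
  by rewrite exprS; exact: contractsM.
have [k kc] : exists k, c ^+ k <= e ^+ 2.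
  have : (fun k => c ^+ k) @ \oo --> (0 : R).
    by apply: cvg_expr; rewrite ger0_norm.
  move=> /cvgr_dist_le /(_ (e ^+ 2)); rewrite exprn_gt0 // => /(_ isT).
  case=> k _ /(_ k (leqnn k)) /=; rewrite sub0r normrN ger0_norm ?exprn_ge0 //.
  by move=> ?; exists k.
exists (P k).
  by rewrite -size_eq0 sP expn_eq0 size_eq0 (negbTE S0).
move=> f M f0 fM E uE; apply: le_trans (cP k f M f0 fM E uE) _.
have M0 : 0 <= M by have := fM [::] isT; rewrite big_nil.
apply: ler_wpM2r => //; rewrite sP natrX exprMn [leRHS]exprMn -!exprM (mulnC k).
by rewrite [leRHS]mulrC; apply: ler_wpM2l; rewrite ?exprn_ge0.
Qed.

End KestenDay.

(** * Square-summable functions and the regular representation *)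

Section Modulus.
Variable R : realType.
Implicit Types z w : R[i].
Local Notation modulus := (@Normc.normc R).

Lemma modulus_ge0 z : 0 <= modulus z.
Proof. by case: z => a b; exact: sqrtr_ge0. Qed.

Lemma modulusD z w : modulus (z + w) <= modulus z + modulus w.
Proof. exact: le_normcD. Qed.

Lemma modulusN z : modulus (- z) = modulus z.
Proof. exact: normcN. Qed.

Lemma modulus_sum (I : Type) (r : seq I) (P : pred I) (z : I -> R[i]) :
  modulus (\sum_(i <- r | P i) z i) <= \sum_(i <- r | P i) modulus (z i).
Proof.
elim/big_ind2: _ => // [|a x b y ha hb]; first by rewrite Normc.normc0.
by apply: le_trans (modulusD _ _) _; exact: lerD.
Qed.

Lemma modulus_natV n : modulus n%:R^-1 = n%:R^-1.
Proof.
rewrite Normc.normcV; congr (_^-1).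
have -> : (n%:R : R[i]) = (n%:R)%:C%C by rewrite rmorph_nat.
by rewrite /= expr0n /= addr0 sqrtr_sqr ger0_norm.
Qed.

End Modulus.

Section L2Space.
Variables (R : realType) (X : choiceType).
Implicit Types u v : l2 R X.
Local Notation modulus := (@Normc.normc R).

Lemma l2P u v : (forall x, val u x = val v x) -> u = v.
Proof. by move=> uv; apply: val_inj; apply/funext. Qed.

Lemma l2valD u v x : val (u + v) x = val u x + val v x.
Proof. by []. Qed.

Lemma l2valB u v x : val (u - v) x = val u x - val v x.
Proof. by []. Qed.

Lemma l2valZ (a : R[i]) u x : val (a *: u) x = a * val u x.
Proof. by []. Qed.

Lemma l2val_sum (I : Type) (r : seq I) (F : I -> l2 R X) x :
  val (\sum_(i <- r) F i) x = \sum_(i <- r) val (F i) x.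
Proof.
elim: r => [|i r IH]; first by rewrite !big_nil.
by rewrite !big_cons l2valD IH.
Qed.

Lemma l2norm_ge0 u : 0 <= l2norm u.
Proof. exact: sqrtr_ge0. Qed.

Lemma sqnorm_ge0 (f : X -> R[i]) : (0 <= sqnorm f)%E.
Proof. by apply: esum_ge0 => x _; rewrite lee_fin sqr_ge0. Qed.

Lemma sqbound_sqnorm (f : X -> R[i]) (M : R) :
  sqbound (fun x => modulus (f x)) M <-> (sqnorm f <= M%:E)%E.
Proof.
split=> [fM|fM E uE].
  apply: ge_ereal_sup => _ [F [fF _] <-].
  rewrite fsbig_finite //= sumEFin lee_fin.
  exact: fM (finmap.fset_uniq (fset_set F)).
rewrite -lee_fin; apply: le_trans fM; rewrite -sumEFin.
apply: esum_ge; exists [set` E]; first by split.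
by rewrite [leLHS]fsbig_seq.
Qed.

Lemma l2norm_sqbound u :
  sqbound (fun x => modulus (val u x)) (l2norm u ^+ 2).
Proof.
apply/sqbound_sqnorm; rewrite /l2norm sqr_sqrtr; last first.
  by apply: fine_ge0; exact: sqnorm_ge0.
rewrite fineK // ge0_fin_numE ?sqnorm_ge0 //.
by have := valP u; rewrite inE.
Qed.

Lemma l2norm_le u (M : R) : 0 <= M ->
  sqbound (fun x => modulus (val u x)) (M ^+ 2) -> l2norm u <= M.
Proof.
move=> M0 /sqbound_sqnorm uM.
rewrite /l2norm -[leRHS]ger0_norm // -sqrtr_sqr ler_wsqrtr // -lee_fin fineK //.
rewrite ge0_fin_numE ?sqnorm_ge0 //.
by have := valP u; rewrite inE.
Qed.

Lemma modulus_le_l2norm u x : modulus (val u x) <= l2norm u.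
Proof.
have := @l2norm_sqbound u [:: x] isT; rewrite big_seq1.
by rewrite ler_sqr ?nnegrE ?modulus_ge0 ?l2norm_ge0.
Qed.

Lemma l2normD u v : l2norm (u + v) <= l2norm u + l2norm v.
Proof.
apply: l2norm_le => [|E uE]; first by rewrite addr_ge0 ?l2norm_ge0.
pose a (b : bool) x := modulus (val (if b then u else v) x).
apply: (@le_trans _ _ (\sum_(x <- E) (\sum_(b <- [:: true; false]) a b x) ^+ 2)).
  apply: ler_sum => x _; rewrite !big_cons big_nil addr0.
  by rewrite ler_sqr ?nnegrE ?addr_ge0 ?modulus_ge0 //; exact: modulusD.
apply: (le_trans (sum_minkowski _ _ _ _)).
rewrite !big_cons big_nil addr0 ler_sqr ?nnegrE ?addr_ge0 ?l2norm_ge0 ?sqrtr_ge0 //.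
have le w : Num.sqrt (\sum_(x <- E) modulus (val w x) ^+ 2) <= l2norm w.
  rewrite -[leRHS]ger0_norm ?l2norm_ge0 // -sqrtr_sqr ler_wsqrtr //.
  exact: l2norm_sqbound.
by apply: lerD; exact: le.
Qed.

Lemma l2normZ (a : R[i]) u : l2norm (a *: u) <= modulus a * l2norm u.
Proof.
apply: l2norm_le => [|E uE]; first by rewrite mulr_ge0 ?modulus_ge0 ?l2norm_ge0.
under eq_bigr do rewrite l2valZ Normc.normcM exprMn.
by rewrite -mulr_sumr exprMn ler_wpM2l ?sqr_ge0 //; exact: l2norm_sqbound.
Qed.

Lemma l2normN u : l2norm (- u) = l2norm u.
Proof.
have le v : l2norm (- v) <= l2norm v.
  rewrite -scaleN1r; apply: le_trans (l2normZ _ _) _.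
  by rewrite modulusN Normc.normc1 mul1r.
by apply/le_anti; rewrite le -{1}[u]opprK le.
Qed.

Lemma l2norm0 : l2norm (0 : l2 R X) = 0.
Proof.
apply/le_anti; rewrite l2norm_ge0 andbT -[0 : l2 R X](scale0r 0).
by apply: le_trans (l2normZ _ _) _; rewrite Normc.normc0 mul0r.
Qed.

Lemma l2norm_sum (I : Type) (r : seq I) (P : pred I) (F : I -> l2 R X) :
  l2norm (\sum_(i <- r | P i) F i) <= \sum_(i <- r | P i) l2norm (F i).
Proof.
elim/big_ind2: _ => // [|a x b y ha hb]; first by rewrite l2norm0.
by apply: le_trans (l2normD _ _) _; exact: lerD.
Qed.

Lemma sqbound_delta (x0 : X) :
  sqbound (fun x => modulus (x == x0)%:R) (1 : R).
Proof.
move=> E uE; rewrite (bigID (pred1 x0)) /= [X in _ + X]big1 ?addr0; last first.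
  by move=> x /negbTE ->; rewrite Normc.normc0 expr0n.
rewrite -big_filter; case: (boolP (x0 \in E)) => x0E.
  by rewrite filter_pred1_uniq // big_seq1 eqxx Normc.normc1 expr1n.
rewrite (eq_in_filter (a2 := pred0)) ?filter_pred0 ?big_nil //.
by move=> x xE /=; apply/eqP => xx0; rewrite -xx0 xE in x0E.
Qed.

Lemma delta_l2_subproof (x0 : X) :
  (fun x => (x == x0)%:R : R[i]) \in @square_summable R X.
Proof.
rewrite inE; apply: (@le_lt_trans _ _ (1 : R)%:E); last exact: ltry.
exact/sqbound_sqnorm/sqbound_delta.
Qed.

Definition delta_l2 (x0 : X) : l2 R X :=
  exist (fun f => f \in @square_summable R X) _ (delta_l2_subproof x0).

Lemma l2norm_delta x0 : l2norm (delta_l2 x0) <= 1.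
Proof. by apply: l2norm_le; rewrite ?expr1n //; exact: sqbound_delta. Qed.

End L2Space.

Section RegularRepresentation.
Variables (R : realType) (G : groupType).
Implicit Types (g h s t : G) (T : l2 R G -> l2 R G) (xi : l2 R G).
Local Notation modulus := (@Normc.normc R).
Local Notation lambda := (@left_regular R G).

Lemma left_regularE g xi x : val (lambda g xi) x = val xi (g^-1 * x)%g.
Proof. by []. Qed.

Lemma left_regularM g h xi : lambda (g * h)%g xi = lambda g (lambda h xi).
Proof. by apply: l2P => x; rewrite !left_regularE invgM mulgA. Qed.

Lemma left_regular1 xi : lambda 1%g xi = xi.
Proof. by apply: l2P => x; rewrite !left_regularE invg1 mul1g. Qed.

Lemma left_regular_linear g : linear (lambda g).
Proof. by move=> a u v; apply: l2P. Qed.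

Lemma l2norm_left_regular g xi : l2norm (lambda g xi) = l2norm xi.
Proof.
have le h eta : l2norm (lambda h eta) <= l2norm eta.
  apply: l2norm_le => [|E uE]; first exact: l2norm_ge0.
  rewrite -(big_map (fun x => h^-1 * x)%g xpredT
    (fun x => modulus (val eta x) ^+ 2)).
  by apply: l2norm_sqbound; rewrite map_inj_uniq //; exact: mulgI.
apply/le_anti; rewrite le /=.
by rewrite -[X in l2norm X <= _]left_regular1 -(mulVg g) left_regularM le.
Qed.

(** Repetitions in [w] are weights, so products of lists give composites of
    averages. *)
Definition conj_average (w : seq G) T xi : l2 R G :=
  (size w)%:R^-1 *: \sum_(s <- w) lambda s (T (lambda s^-1%g xi)).

Lemma opnorm_conj_average (w : seq G) T (c : R) :
  0 <= c -> opnorm_le T c -> opnorm_le (conj_average w T) c.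
Proof.
move=> c0 Tc xi; apply: (le_trans (l2normZ _ _)); rewrite modulus_natV.
have cx : 0 <= c * l2norm xi by rewrite mulr_ge0 ?l2norm_ge0.
have : l2norm (\sum_(s <- w) lambda s (T (lambda s^-1%g xi))) <=
    (size w)%:R * (c * l2norm xi).
  apply: (le_trans (l2norm_sum _ _ _)); rewrite -sum_const_seq.
  apply: ler_sum => s _; rewrite l2norm_left_regular.
  by rewrite -[X in _ <= _ * X](l2norm_left_regular s^-1%g) Tc.
case: w => [_|s w h]; first by rewrite /= invr0 mul0r.
by rewrite mulrC ler_pdivrMr ?ltr0n // mulrC.
Qed.

Lemma conj_average_left_regular (w : seq G) t xi :
  conj_average w (lambda t) xi =
  (size w)%:R^-1 *: \sum_(s <- w) lambda (s * t * s^-1)%g xi.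
Proof.
by congr (_ *: _); apply: eq_bigr => s _; rewrite !left_regularM.
Qed.

Lemma conj_average_mul (w w' : seq G) T xi :
  conj_average [seq (s * s')%g | s <- w, s' <- w'] T xi =
  conj_average w (conj_average w' T) xi.
Proof.
rewrite /conj_average size_allpairs natrM invfM -scalerA.
congr (_ *: _); rewrite big_allpairs_dep scaler_sumr; apply: eq_bigr => s _.
apply: l2P => x; rewrite left_regularE !l2valZ !l2val_sum; congr (_ * _).
by apply: eq_bigr => s' _; rewrite left_regularM invgM left_regularM.
Qed.

End RegularRepresentation.

(** * Powers' averaging property and simplicity *)

Section PowersAveraging.
Variables (R : realType) (G : groupType).
Implicit Types (g h s t : G) (S T : l2 R G -> l2 R G) (xi : l2 R G).
Local Notation modulus := (@Normc.normc R).
Local Notation lambda := (@left_regular R G).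
Local Notation delta := (delta_l2 R (1%g : G)).
Local Notation A := (@reduced_cstar_algebra R G).

Definition powers_averaging : Prop :=
  forall (ts : seq G) (e : R), 0 < e -> (forall t, t \in ts -> t != 1%g) ->
    exists2 w : seq G, w != [::] &
      forall t, t \in ts -> opnorm_le (conj_average w (lambda t)) e.

Lemma opnorm_leB0 T : opnorm_le (T - T) 0.
Proof. by move=> xi; rewrite subrr mul0r l2norm0. Qed.

Lemma left_regular_bounded g : bounded_operator (lambda g).
Proof.
split; first exact: left_regular_linear.
by exists 1 => xi; rewrite mul1r l2norm_left_regular.
Qed.

Lemma left_regular_in_cstar g : A (lambda g).
Proof.
split; first exact: left_regular_bounded.
move=> e e0; exists (lambda g).
  exists [:: (1, g)]; rewrite big_seq1 /=.
  by apply/funext => xi; rewrite /GRing.scale /= scale1r.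
move=> xi; apply: le_trans (opnorm_leB0 _ _) _.
by rewrite mul0r mulr_ge0 ?l2norm_ge0 // ltW.
Qed.

Lemma group_algebraE (p : seq (R[i] * G)) xi :
  (\sum_(q <- p) q.1 *: lambda q.2) xi = \sum_(q <- p) q.1 *: lambda q.2 xi.
Proof.
elim: p => [|q p IH]; first by rewrite !big_nil.
by rewrite !big_cons -IH.
Qed.

Lemma group_algebra_delta (p : seq (R[i] * G)) g :
  val (\sum_(q <- p) q.1 *: lambda q.2 delta) g = \sum_(q <- p | q.2 == g) q.1.
Proof.
rewrite l2val_sum [RHS]big_mkcond; apply: eq_bigr => q _.
rewrite l2valZ left_regularE /= mulg_eq1 eqg_inv.
by case: eqP => _; rewrite ?mulr1 ?mulr0.
Qed.

(** The coefficients of [S xi] are pairings of translates of [xi] with the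
    coefficient function [S delta] of [S]. *)
Lemma group_algebra_coef_le (S : l2 R G -> l2 R G) xi x :
  group_algebra_image S ->
  modulus (val (S xi) x) <= l2norm (S delta) * l2norm xi.
Proof.
move=> [p ->]; rewrite !group_algebraE.
set Sd := \sum_(q <- p) _ *: lambda _ delta.
(* The coefficients of repeated group elements in [p] have to be added up before
   the Cauchy-Schwarz inequality is applied. *)
pose K := undup (map snd p).
have -> : val (\sum_(q <- p) q.1 *: lambda q.2 xi) x =
    \sum_(g <- K) val Sd g * val xi (g^-1 * x)%g.
  transitivity (\sum_(q <- p | q.2 \in K) q.1 * val xi (q.2^-1 * x)%g).
    rewrite l2val_sum big_seq [RHS]big_seq_cond; apply: eq_bigl => q.
    case: (boolP (q \in p)) => //= qp.
    by rewrite mem_undup; apply/esym/mapP; exists q.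
  rewrite -(sum_fibers snd) ?undup_uniq //; apply: eq_bigr => g _.
  by rewrite group_algebra_delta mulr_suml; apply: eq_bigr => q /eqP ->.
apply: (le_trans (modulus_sum _ _ _)).
under eq_bigr do rewrite Normc.normcM.
rewrite -[leRHS]ger0_norm ?mulr_ge0 ?l2norm_ge0 // -[leLHS]ger0_norm; last first.
  by apply: sumr_ge0 => g _; rewrite mulr_ge0 ?modulus_ge0.
rewrite -ler_sqr ?nnegrE ?normr_ge0 // !real_normK ?num_real // exprMn.
apply: (le_trans (sum_cauchy_schwarz _ _ _ _)).
apply: ler_pM; rewrite ?sum_sqr_ge0 //.
  by apply: l2norm_sqbound; exact: undup_uniq.
rewrite -(big_map (fun g => g^-1 * x)%g xpredT (fun y => modulus (val xi y) ^+ 2)).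
apply: l2norm_sqbound; rewrite map_inj_uniq ?undup_uniq //.
by move=> g h /mulIg/invg_inj.
Qed.

(** The vector [delta] is separating.  The bound of [group_algebra_coef_le] passes
    to limits in norm because it mentions [S] only through [S delta]. *)
Lemma cstar_separating T xi : A T -> T delta = 0 -> T xi = 0.
Proof.
move=> [_ Tap] Td; apply: l2P => x; apply: Normc.eq0_normc; apply/le_anti.
rewrite modulus_ge0 andbT; apply/ler_addgt0Pr => e e0; rewrite add0r.
pose N := l2norm xi + 1.
have N0 : 0 < N by rewrite ltr_wpDl ?l2norm_ge0.
have [|S SA TS] := Tap (e / (2 * N)); first by rewrite divr_gt0 ?mulr_gt0.
have c0 : 0 <= e / (2 * N) by rewrite divr_ge0 ?mulr_ge0 ?ltW.
have Sd : l2norm (S delta) <= e / (2 * N).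
  rewrite -l2normN -[- S delta]add0r -Td.
  apply: (le_trans (TS delta)); rewrite ler_piMr //; exact: l2norm_delta.
have -> : val (T xi) x = val (S xi) x + val ((T - S) xi) x.
  by rewrite [val ((T - S) xi) x]l2valB addrC subrK.
apply: (le_trans (modulusD _ _)).
have h1 : modulus (val (S xi) x) <= e / (2 * N) * l2norm xi.
  apply: (le_trans (group_algebra_coef_le _ _ SA)).
  by rewrite ler_wpM2r ?l2norm_ge0.
have h2 := le_trans (modulus_le_l2norm _ x) (TS xi).
apply: (le_trans (lerD h1 h2)).
have : e / (2 * N) * l2norm xi <= e / (2 * N) * N.
  by rewrite ler_wpM2l // lerDl.
have -> : e / (2 * N) * N = e / 2 by field; rewrite gt_eqF.
by lra.
Qed.

Lemma conj_averageD (w : seq G) S T :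
  conj_average w (S + T) = conj_average w S + conj_average w T.
Proof.
apply/funext => xi; apply: l2P => x.
rewrite l2valD !l2valZ -mulrDr !l2val_sum -big_split /=.
by congr (_ * _); apply: eq_bigr => s _.
Qed.

Lemma conj_averageZ (w : seq G) (a : R[i]) T :
  conj_average w (a *: T) = a *: conj_average w T.
Proof.
apply/funext => xi; apply: l2P => x.
rewrite [RHS]l2valZ !l2valZ !l2val_sum mulrCA; congr (_ * _).
by rewrite mulr_sumr; apply: eq_bigr => s _.
Qed.

Lemma conj_average0 (w : seq G) : conj_average w (0 : l2 R G -> l2 R G) = 0.
Proof. by rewrite -[X in conj_average w X](scale0r 0) conj_averageZ scale0r. Qed.

Lemma conj_average_sum (w : seq G) (I : Type) (r : seq I)
    (F : I -> l2 R G -> l2 R G) :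
  conj_average w (\sum_(i <- r) F i) = \sum_(i <- r) conj_average w (F i).
Proof.
elim: r => [|i r IH]; first by rewrite !big_nil conj_average0.
by rewrite !big_cons conj_averageD IH.
Qed.

(** Nonemptiness of [w] matters: the empty average is 0. *)
Lemma conj_average_lambda1 (w : seq G) : w != [::] ->
  conj_average w (lambda 1%g) = lambda 1%g.
Proof.
move=> w0; apply/funext => xi; rewrite conj_average_left_regular.
rewrite (eq_bigr (fun=> xi)); last by move=> s _; rewrite mulg1 mulgV left_regular1.
rewrite left_regular1; apply: l2P => x; rewrite l2valZ l2val_sum.
rewrite big_const_seq count_predT iter_addr_0 -[val xi x *+ _]mulr_natl mulrA.
by rewrite mulVf ?mul1r // pnatr_eq0 size_eq0.
Qed.

(** Split an approximation of [T] in the group algebra into its term at the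
    identity, which is close to 1 and is unchanged by averaging, and a finite
    combination of other group elements, which averaging makes small. *)
Lemma conj_average_near1 T (e : R) :
  powers_averaging -> A T -> val (T delta) 1%g = 1 -> 0 < e ->
  exists w, opnorm_le (lambda 1%g - conj_average w T) e.
Proof.
move=> PA [_ Tap] T1 e0.
have e3 : 0 < e / 3 by rewrite divr_gt0.
have [S [p SE] TS] := Tap _ e3.
pose a := \sum_(q <- p | q.2 == 1%g) q.1.
pose C := \sum_(q <- p | q.2 != 1%g) modulus q.1.
have C0 : 0 <= C by apply: sumr_ge0 => q _; exact: modulus_ge0.
have C1 : 0 < C + 1 by rewrite ltr_wpDl.
(* The [+ 1] only guards against [C = 0]. *)
have [||w w0 wp] := PA [seq t <- map snd p | t != 1%g] (e / (3 * (C + 1))).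
- by rewrite divr_gt0 ?mulr_gt0.
- by move=> t; rewrite mem_filter => /andP[].
exists w => xi.
have a1 : modulus (1 - a) <= e / 3.
  have -> : 1 - a = val ((T - S) delta) 1%g.
    by rewrite [RHS]l2valB T1 SE group_algebraE group_algebra_delta.
  apply: (le_trans (modulus_le_l2norm _ _)); apply: (le_trans (TS delta)).
  by apply: ler_piMr; [exact: ltW|exact: l2norm_delta].
have -> : (lambda 1%g - conj_average w T) xi = (1 - a) *: xi -
    conj_average w (T - S) xi -
    \sum_(q <- p | q.2 != 1%g) q.1 *: conj_average w (lambda q.2) xi.
  have SE' : conj_average w S xi = a *: xi +
      \sum_(q <- p | q.2 != 1%g) q.1 *: conj_average w (lambda q.2) xi.
    rewrite SE conj_average_sum.
    have -> : (\sum_(q <- p) conj_average w (q.1 *: lambda q.2)) xi =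
        \sum_(q <- p) q.1 *: conj_average w (lambda q.2) xi.
      elim: (p) => [|q p' IH]; first by rewrite !big_nil.
      by rewrite !big_cons -IH conj_averageZ.
    rewrite (bigID (fun q => q.2 == 1%g)) /= scaler_suml; congr (_ + _).
    by apply: eq_bigr => q /eqP ->; rewrite conj_average_lambda1 // left_regular1.
  have TE : conj_average w T xi = conj_average w (T - S) xi + conj_average w S xi.
    by rewrite -{1}(subrK S T) [in LHS]conj_averageD.
  transitivity (lambda 1%g xi - conj_average w T xi) => //.
  rewrite TE SE' left_regular1 scalerBl scale1r.
  set u := \sum_(q <- _ | _) _.
  apply: l2P => x; rewrite !(l2valB, l2valD); ring.
apply: (le_trans (l2normD _ _)); rewrite l2normN.
have h1 : l2norm ((1 - a) *: xi - conj_average w (T - S) xi) <=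
    e / 3 * l2norm xi + e / 3 * l2norm xi.
  apply: (le_trans (l2normD _ _)); rewrite l2normN; apply: lerD.
    by apply: (le_trans (l2normZ _ _)); rewrite ler_wpM2r ?l2norm_ge0.
  by apply: opnorm_conj_average; rewrite ?ltW.
have h2 : l2norm (\sum_(q <- p | q.2 != 1%g) q.1 *: conj_average w (lambda q.2) xi)
    <= C * (e / (3 * (C + 1)) * l2norm xi).
  apply: (le_trans (l2norm_sum _ _ _)); rewrite mulr_suml.
  rewrite big_seq_cond [leRHS]big_seq_cond; apply: ler_sum => q /andP[qp q1].
  apply: (le_trans (l2normZ _ _)); rewrite ler_wpM2l ?modulus_ge0 //.
  by apply: wp; rewrite mem_filter q1 map_f.
have h3 : C * (e / (3 * (C + 1)) * l2norm xi) <= e / 3 * l2norm xi.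
  rewrite mulrA ler_wpM2r ?l2norm_ge0 //.
  have -> : e / 3 = (C + 1) * (e / (3 * (C + 1))) by field; rewrite gt_eqF.
  by rewrite ler_wpM2r ?lerDl // divr_ge0 ?mulr_ge0 ?ltW.
by lra.
Qed.

Lemma ideal_conj_average (J : set (l2 R G -> l2 R G)) (w : seq G) T :
  closed_ideal A J -> J T -> J (conj_average w T).
Proof.
move=> [[_ J0 JD JZ] JM _] JT.
have -> : conj_average w T =
    (size w)%:R^-1 *: \sum_(s <- w) (lambda s \o (T \o lambda s^-1%g)).
  apply/funext => xi; apply: l2P => x.
  rewrite [RHS]l2valZ [LHS]l2valZ; congr (_ * val _ x).
  by elim: (w) => [|s w' IH]; rewrite ?big_nil // !big_cons IH.
apply: JZ; elim/big_ind: _ => // s _.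
apply: (JM _ _ (left_regular_in_cstar s) _).1.
exact: (JM _ _ (left_regular_in_cstar s^-1%g) JT).2.
Qed.

(** A nonzero [T] in the ideal has a nonzero coefficient at some [g], since [delta]
    is separating; moving it to the identity by [lambda g^-1] and normalising
    makes [conj_average_near1] applicable. *)
Theorem powers_averaging_simple : powers_averaging -> cstar_simple R G.
Proof.
move=> PA; split=> [A0|J JI].
  have : A (lambda 1%g) by exact: left_regular_in_cstar.
  rewrite A0 => /(congr1 (fun T => val (T delta) 1%g)).
  rewrite left_regular1 /= eqxx => /eqP; by rewrite oner_eq0.
have [[JA J0 JD JZ] JM Jcl] := JI.
have [Jtriv|] := pselect (J `<=` [set 0]).
  by left; apply/seteqP; split=> // _ ->.
move=> /existsNP[T /not_implyP[JT T0]]; right.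
have Td : T delta <> 0.
  move=> Td; apply: T0; apply/funext => xi.
  by apply: cstar_separating Td; exact: JA.
have [g Tg] : exists g, val (T delta) g <> 0.
  by apply: contrapT => /forallNP h; apply: Td; apply: l2P => x; apply: contrapT.
pose T1 := (val (T delta) g)^-1 *: (lambda g^-1%g \o T).
have JT1 : J T1.
  by apply: JZ; apply: (JM _ _ (left_regular_in_cstar g^-1%g) JT).1.
have T11 : val (T1 delta) 1%g = 1.
  rewrite [LHS]l2valZ left_regularE invgK mulg1 mulVf //; exact/eqP.
have J1 : J (lambda 1%g).
  apply: Jcl; split; first exact: left_regular_bounded.
  move=> e e0; have [w we] := conj_average_near1 PA (JA _ JT1) T11 e0.
  by exists (conj_average w T1) => //; exact: ideal_conj_average.
apply/seteqP; split=> // S SA.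
suff -> : S = S \o lambda 1%g by exact: (JM _ _ SA J1).1.
by apply/funext => xi; rewrite /= left_regular1.
Qed.

End PowersAveraging.

(** * Averaging in disjoint supports *)

Section CommutingCopies.
Variables (R : realType) (Gam G : groupType) (iota : Gam -> G).
Hypothesis iotaM : {morph iota : a b / (a * b)%g}.
Local Notation modulus := (@Normc.normc R).
Local Notation lambda := (@left_regular R G).

Lemma morph_group1 : iota 1%g = 1%g.
Proof. by apply: (mulgI (iota 1%g)); rewrite -iotaM !mulg1. Qed.

Lemma morph_groupV a : iota a^-1%g = (iota a)^-1%g.
Proof. by apply: (mulgI (iota a)); rewrite -iotaM !mulgV morph_group1. Qed.

(** The images of [iota] and [kappa] generate their direct product and [iota] is
    injective.  The group [G] is a disjoint union of right cosets of this
    product; [theta] reads off the coordinate along [iota], after a choice of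
    base points. *)
Lemma coset_coordinate (kappa : Gam -> G) :
  {morph kappa : a b / (a * b)%g} ->
  (forall a b, (iota a * kappa b = kappa b * iota a)%g) ->
  (forall a b, iota a = kappa b -> a = 1%g) ->
  exists theta : G -> Gam,
    forall a b x, theta (kappa b * iota a * x)%g = (a * theta x)%g.
Proof.
move=> kappaM comm triv.
have kappa1 : kappa 1%g = 1%g.
  by apply: (mulgI (kappa 1%g)); rewrite -kappaM !mulg1.
have kappaV b : kappa b^-1%g = (kappa b)^-1%g.
  by apply: (mulgI (kappa b)); rewrite -kappaM !mulgV kappa1.
pose act a b x := (kappa b * iota a * x)%g.
have actM a b a' b' x : act a b (act a' b' x) = act (a * a')%g (b * b')%g x.
  rewrite /act iotaM kappaM !mulgA; congr (_ * _)%g.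
  by rewrite -!mulgA; congr (_ * _)%g; rewrite !mulgA comm.
have act1 x : act 1%g 1%g x = x by rewrite /act morph_group1 kappa1 !mul1g.
have act_free a b a' b' x : act a b x = act a' b' x -> a = a'.
  move=> /mulIg E; apply/esym/divg1_eq/(@triv _ (b'^-1 * b)%g).
  rewrite iotaM kappaM morph_groupV kappaV; apply: (mulIg (iota a)).
  by rewrite mulgVK -mulgA E mulKg.
(* Orbits of [act]; [r] picks a base point in each orbit, depending on
   the orbit only. *)
pose cls x := [set y | exists a b, y = act a b x].
have cls_act a b x : cls (act a b x) = cls x.
  apply/seteqP; split=> y [a' [b' ->]].
    by exists (a' * a)%g, (b' * b)%g; rewrite actM.
  by exists (a' * a^-1)%g, (b' * b^-1)%g; rewrite actM !mulgVK.
have cls_refl x : cls x x by exists 1%g, 1%g; rewrite act1.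
pose r x := xget 1%g (cls x).
have rP x : exists a, exists b, x = act a b (r x).
  have : cls x (r x) by apply: xgetI (cls_refl x).
  move=> [a [b ->]]; exists a^-1%g, b^-1%g.
  by rewrite actM !mulVg act1.
have /choice[theta thetaP] := rP.
exists theta => a b x; rewrite -/(act a b x).
have [b1 E1] := thetaP (act a b x); have [b2 E2] := thetaP x.
have rE : r (act a b x) = r x by rewrite /r cls_act.
by move: E1; rewrite rE {1}E2 actM => /act_free.
Qed.

(** Up to the unitary [lambda t], conjugating [t] by [iota s] translates by
    [kappa s * iota s^-1], where [kappa] is [iota] conjugated by [t].  These
    translations cover the translations by [s] under [coset_coordinate], so the
    bound on [Gam] is inherited although they do not come from a homomorphism. *)
Lemma opnorm_conj_average_morph (S : seq Gam) (e : R) (t : G) :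
  S != [::] -> 0 <= e -> contracts S ((e * (size S)%:R) ^+ 2) ->
  (forall a b, (iota a * (t * iota b * t^-1) = (t * iota b * t^-1) * iota a)%g) ->
  (forall a b, iota a = (t * iota b * t^-1)%g -> a = 1%g) ->
  opnorm_le (conj_average (map iota S) (lambda t)) e.
Proof.
move=> S0 e0 cS comm triv xi.
pose kappa b := (t * iota b * t^-1)%g.
have kappaM : {morph kappa : a b / (a * b)%g}.
  by move=> a b; rewrite /kappa iotaM !mulgA mulgVK.
have [theta thetaE] := coset_coordinate kappaM comm triv.
pose sigma s x := (kappa s * iota s^-1 * x)%g.
pose f x := modulus (val (lambda t xi) x).
pose n : R := (size S)%:R.
have n0 : 0 < n by rewrite ltr0n lt0n size_eq0.
have fM : sqbound f (l2norm xi ^+ 2).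
  by rewrite -(l2norm_left_regular t); exact: l2norm_sqbound.
have bound := contracts_fibred (sigma := sigma) (theta := theta)
  (fun s => @mulgI _ _) (fun s x => thetaE _ _ _) cS
  (fun x => modulus_ge0 _) fM.
apply: l2norm_le => [|E uE]; first by rewrite mulr_ge0 ?l2norm_ge0.
rewrite -(@ler_pM2l _ (n ^+ 2)) ?exprn_gt0 // mulr_sumr.
have -> : n ^+ 2 * (e * l2norm xi) ^+ 2 = (e * n) ^+ 2 * l2norm xi ^+ 2 by ring.
apply: le_trans (bound E uE); apply: ler_sum => x _.
have h : modulus (val (conj_average (map iota S) (lambda t) xi) x) * n <=
    \sum_(s <- S) f (sigma s x).
  rewrite conj_average_left_regular l2valZ Normc.normcM modulus_natV size_map -/n.
  rewrite mulrAC mulVf ?gt_eqF // mul1r l2val_sum big_map.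
  apply: (le_trans (modulus_sum _ _ _)); apply: ler_sum => s _.
  rewrite /f /sigma /kappa !left_regularE !invgM invgK morph_groupV.
  by rewrite !mulgA mulVg mul1g.
rewrite mulrC -exprMn ler_sqr ?nnegrE //.
- by rewrite mulr_ge0 ?modulus_ge0 // ltW.
- by apply: sumr_ge0 => s _; exact: modulus_ge0.
Qed.

End CommutingCopies.

Section Dynamics.
Variables (R : realType) (G : groupType) (Z : Type) (act : G -> Z -> Z).
Hypothesis act1 : forall z, act 1%g z = z.
Hypothesis actM : forall g h z, act (g * h)%g z = act g (act h z).
Hypothesis act_faithful : forall g h, (forall z, act g z = act h z) -> g = h.
Implicit Types (g h s t : G) (U V : set Z).
Local Notation lambda := (@left_regular R G).

Definition supported_in U g : Prop := forall z, ~ U z -> act g z = z.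

Definition displaces g U : Prop := forall z, U z -> ~ U (act g z).

Lemma actK g : cancel (act g) (act g^-1%g).
Proof. by move=> z; rewrite -actM mulVg act1. Qed.

Lemma actVK g : cancel (act g^-1%g) (act g).
Proof. by move=> z; rewrite -actM mulgV act1. Qed.

Lemma supported_inV U g : supported_in U g -> supported_in U g^-1%g.
Proof. by move=> sg z /sg {1}<-; rewrite actK. Qed.

Lemma supported_in_preserves U g z : supported_in U g -> U z -> U (act g z).
Proof.
move=> sg Uz; apply: contrapT => /[dup] /(supported_inV sg) E.
by rewrite -E actK.
Qed.

Lemma supported_in_commute U V g h : U `&` V = set0 ->
  supported_in U g -> supported_in V h -> (g * h = h * g)%g.
Proof.
move=> UV gU hV; apply: act_faithful => z; rewrite !actM.
have disj x : U x -> V x -> False.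
  by move=> Ux Vx; suff: set0 x by []; rewrite -UV.
have [Uz|nUz] := pselect (U z).
  rewrite (hV z) ?(hV (act g z)) //; last exact: disj.
  by apply: disj; exact: supported_in_preserves.
rewrite (gU z nUz) gU // => Uhz; apply: nUz.
have [Vz|nVz] := pselect (V z); last by rewrite -(hV z nVz).
by exfalso; apply: disj Uhz _; exact: supported_in_preserves.
Qed.

(** The average [w] is required to work for all elements that displace [U] at
    once; this uniformity is what allows several domains to be combined. *)
Definition averaging_domain U : Prop :=
  forall e : R, 0 < e -> exists2 w : seq G, w != [::] &
    (forall s, s \in w -> supported_in U s) /\
    (forall t, displaces t U -> opnorm_le (conj_average w (lambda t)) e).

(** The conjugate of the copy by an element displacing [U] is supported off [U],
    so it commutes with the copy and shares only the identity with it. *)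
Lemma averaging_domain_nonamenable (Gam : groupType) (iota : Gam -> G) U :
  ~ amenable R Gam -> {morph iota : a b / (a * b)%g} ->
  (forall a, iota a = 1%g -> a = 1%g) -> (forall a, supported_in U (iota a)) ->
  averaging_domain U.
Proof.
move=> na iotaM iotaI iotaU e e0.
have [S S0 cS] := nonamenable_contracts_small na e0.
exists (map iota S); first by case: (S) S0.
split=> [s /mapP[a _ ->]|t tU]; first exact: iotaU.
pose V := [set z | U (act t^-1%g z)].
have UV : U `&` V = set0.
  by apply/seteqP; split=> // z [Uz /tU]; rewrite actVK.
have conjV a : supported_in V (t * iota a * t^-1)%g.
  by move=> z Vz; rewrite !actM iotaU // actVK.
apply: opnorm_conj_average_morph => //; first exact: ltW.
  by move=> a b; exact: supported_in_commute UV _ _.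
move=> a b E; apply: iotaI; apply: act_faithful => z; rewrite act1.
have [Uz|] := pselect (U z); last exact: iotaU.
by rewrite E conjV // => Vz; suff: set0 z by []; rewrite -UV.
Qed.

Lemma opnorm_average (w : seq G) (F : G -> l2 R G -> l2 R G) (e : R) :
  0 <= e -> (forall s, s \in w -> opnorm_le (F s) e) ->
  opnorm_le (fun xi => (size w)%:R^-1 *: \sum_(s <- w) F s xi) e.
Proof.
move=> e0 Fe xi; apply: (le_trans (l2normZ _ _)); rewrite modulus_natV.
have : l2norm (\sum_(s <- w) F s xi) <= (size w)%:R * (e * l2norm xi).
  apply: (le_trans (l2norm_sum _ _ _)); rewrite -sum_const_seq.
  by rewrite big_seq [leRHS]big_seq; apply: ler_sum => s /Fe.
case: (w) => [_|s w' h]; first by rewrite /= invr0 mul0r mulr_ge0 ?l2norm_ge0.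
by rewrite mulrC ler_pdivrMr ?ltr0n // mulrC.
Qed.

(** Conjugating by [w'] first only replaces [t] by its conjugates. *)
Lemma conj_averageC (w w' : seq G) t xi :
  conj_average w (conj_average w' (lambda t)) xi =
  (size w')%:R^-1 *: \sum_(s <- w') conj_average w (lambda (s * t * s^-1)%g) xi.
Proof.
apply: l2P => x; rewrite /conj_average !(l2valZ, l2val_sum).
under eq_bigr do rewrite left_regularE l2valZ l2val_sum.
rewrite -mulr_sumr mulrCA; congr (_ * _).
under [RHS]eq_bigr do rewrite l2valZ l2val_sum.
rewrite -mulr_sumr exchange_big /=; congr (_ * _).
by apply: eq_bigr => s' _; apply: eq_bigr => s _; rewrite !invgM !mulgA.
Qed.

(** By induction, composing the averages of the domains.  On elements displacing
    an earlier domain, the new average cannot increase the norm.  On elements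
    displacing the last one, the earlier average conjugates them by elements
    that fix it pointwise, and the conjugates still displace it. *)
Lemma averaging_domains (U : nat -> set Z) (m : nat) (e : R) : 0 < e ->
  (forall i, (i < m)%N -> averaging_domain (U i)) ->
  (forall i j, (i < m)%N -> (j < m)%N -> i <> j -> U i `&` U j = set0) ->
  exists2 w : seq G, w != [::] &
    (forall s z, s \in w -> (forall i, (i < m)%N -> ~ U i z) -> act s z = z) /\
    (forall i t, (i < m)%N -> displaces t (U i) ->
      opnorm_le (conj_average w (lambda t)) e).
Proof.
move=> e0; elim: m => [|m IH] dom disj.
  exists [:: 1%g] => //; split=> // s z; rewrite inE => /eqP -> _.
  exact: act1.
have [||w' w'0 [w'U w'e]] := IH.
- by move=> i im; apply: dom; exact: ltnW.
- by move=> i j im jm; apply: disj; exact: ltnW.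
have [w w0 [wU we]] := dom m (ltnSn m) e e0.
exists [seq (s * s')%g | s <- w, s' <- w'].
  by rewrite -size_eq0 size_allpairs muln_eq0 !size_eq0 negb_or w0.
split=> [_ z /allpairsP[[s s'] /= [sw s'w' ->]] zU|i t im tU].
  rewrite actM (w'U s' z) // => [|i im]; last by apply: zU; exact: ltnW.
  by apply: wU sw _ _; exact: zU.
move=> xi; rewrite conj_average_mul.
move: im; rewrite ltnS leq_eqVlt => /predU1P[im|im]; last first.
  exact: (opnorm_conj_average w (ltW e0) (w'e i t im tU) xi).
rewrite conj_averageC.
have := @opnorm_average w' (fun s => conj_average w (lambda (s * t * s^-1)%g)) e.
move=> /(_ (ltW e0)); apply=> s sw'.
apply: we => z Uz.
have fixU z' : U m z' -> act s z' = z'.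
  move=> Uz'; apply: w'U => // j jm Ujz'.
  suff : set0 z' by [].
  rewrite -(disj j m) //; first exact: ltnW.
  by move=> jE; rewrite jE ltnn in jm.
rewrite !actM -{1}(fixU z Uz) actK => Ustz.
(* If [s] maps [act t z] into [U m], then [act t z] is there already, as [s] is
   the identity on [U m]. *)
have E : act s (act t z) = act t z.
  by rewrite -{2}(actK s (act t z)) -{2}(fixU _ Ustz) actK.
by apply: (tU z); rewrite im // -E.
Qed.

(** One domain for each of the given elements, pairwise disjoint, provides the
    average required by [powers_averaging]. *)
Theorem averaging_domains_cstar_simple :
  (forall ts : seq G, (forall t, t \in ts -> t != 1%g) ->
    exists U : nat -> set Z,
      [/\ forall i, (i < size ts)%N -> averaging_domain (U i),
          forall i j, (i < size ts)%N -> (j < size ts)%N -> i <> j ->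
            U i `&` U j = set0 &
          forall i, (i < size ts)%N -> displaces (nth 1%g ts i) (U i)]) ->
  cstar_simple R G.
Proof.
move=> dom; apply: powers_averaging_simple => ts e e0 /dom[U [Udom Udisj tU]].
have [w w0 [_ we]] := averaging_domains e0 Udom Udisj.
exists w => // t tts; have ti : (index t ts < size ts)%N by rewrite index_mem.
by apply: (we _ t ti); have := tU _ ti; rewrite nth_index.
Qed.

End Dynamics.

(** * Copying a lift into an arc *)

Section Lifts.
Variable R : realType.
Implicit Types (f g : R -> R) (x y : R).

Lemma lift_intD g : (forall x, g (x + 1) = g x + 1) ->
  forall x (m : int), g (x + m%:~R) = g x + m%:~R.
Proof.
move=> g1 x [n|n]; first exact: lift_natD.
rewrite NegzE rmorphN /= -pmulrn; apply: (addIr n.+1%:R).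
by rewrite -(lift_natD g1) !subrK.
Qed.

(** Lifts normalised at 0: they fix all integers, so they preserve integer
    parts. *)
Definition pointed_lift g : Prop :=
  [/\ {homo g : x y / x < y}, forall x, g (x + 1) = g x + 1 & g 0 = 0].

Lemma pointed_lift_int g (m : int) : pointed_lift g -> g m%:~R = m%:~R.
Proof. by move=> [_ g1 g0]; rewrite -[X in g X]add0r lift_intD // g0 add0r. Qed.

Lemma pointed_lift_floor g x : pointed_lift g ->
  Num.floor (g x) = Num.floor x.
Proof.
move=> gl; apply: floor_def; have /andP[x1 x2] := floor_itv x.
have [gi _ _] := gl; rewrite -{1}(pointed_lift_int (Num.floor x) gl).
rewrite -(pointed_lift_int (Num.floor x + 1) gl) gi // andbT.
exact: ltW_homo gi _ _ x1.
Qed.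

(** The increasing bijection [g] maps open intervals onto open intervals. *)
Lemma increasing_inv_continuous f g : {homo g : x y / x < y} ->
  cancel f g -> cancel g f -> continuous f.
Proof.
move=> gi fK gK y.
have gL : {mono g : x y / x < y} by apply: leW_mono; exact: le_mono.
apply/cvgrPdist_lt => e e0.
have h1 : g (f y - e) < y by rewrite -[ltRHS]fK gL; lra.
have h2 : y < g (f y + e) by rewrite -[ltLHS]fK gL; lra.
near=> z.
have : g (f y - e) < z by near: z; exact: lt_nbhsr.
have : z < g (f y + e) by near: z; exact: lt_nbhsl.
by rewrite -{1 2}(fK z) !gL distrC ltr_distl => -> ->.
Unshelve. all: by end_near. Qed.

Section Arc.
Variables (N j : nat).
Hypothesis N0 : (0 < N)%N.

(** Working modulo [N] makes the arc invariant under integer translations, so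
    that it is a subset of the circle. *)
Definition in_arc x : bool := (N%:Z %| Num.floor (N%:R * x) - j%:Z)%Z.

(** On the interval from [k / N] to [(k + 1) / N], [g (N x) / N] is the copy of
    [g] shrunk by [N] and moved by [k / N]: no translation appears because [g]
    commutes with integer translations. *)
Definition arc_lift g x : R := if in_arc x then g (N%:R * x) / N%:R else x.

Let NR0 : (0 : R) < N%:R. Proof. by rewrite ltr0n. Qed.

Lemma in_arcDint x (m : int) : in_arc (x + m%:~R) = in_arc x.
Proof.
rewrite /in_arc mulrDr floorDrz ?rpredM ?natr_int ?intr_int // addrAC.
have -> : (N%:R : R) * m%:~R = (N%:Z * m)%:~R by rewrite intrM.
by rewrite intrKfloor rpredDr // dvdz_mulr.
Qed.

Lemma arc_lift_floor g x : pointed_lift g ->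
  Num.floor (N%:R * arc_lift g x) = Num.floor (N%:R * x).
Proof.
move=> gl; rewrite /arc_lift; case: ifP => // _.
by rewrite mulrC divfK ?gt_eqF // pointed_lift_floor.
Qed.

Lemma in_arc_lift g x : pointed_lift g -> in_arc (arc_lift g x) = in_arc x.
Proof. by move=> gl; rewrite /in_arc arc_lift_floor. Qed.

(** Both pieces of [arc_lift] preserve the integer part of [N x], so points do not
    leave or enter the arc. *)
Lemma arc_lift_comp f g x : pointed_lift g ->
  arc_lift f (arc_lift g x) = arc_lift (f \o g) x.
Proof.
move=> gl; rewrite {1}/arc_lift in_arc_lift // /arc_lift.
case: ifP => [->|->] //=; rewrite (mulrC _ (_ / _)).
by rewrite divfK ?gt_eqF.
Qed.

Lemma arc_lift_id x : arc_lift idfun x = x.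
Proof.
by rewrite /arc_lift; case: ifP => //= _; rewrite mulrAC divff ?mul1r ?gt_eqF.
Qed.

Lemma pointed_arc_lift g : pointed_lift g -> pointed_lift (arc_lift g).
Proof.
move=> gl; have [gi g1 g0] := gl; split.
- move=> x y xy; rewrite -(ltr_pM2l NR0).
  have xy' : N%:R * x < N%:R * y by rewrite ltr_pM2l.
  have [fxy|fxy] := eqVneq (Num.floor (N%:R * x)) (Num.floor (N%:R * y)).
    rewrite /arc_lift /in_arc fxy; case: ifP => // _.
    by rewrite !(mulrC _ (_ / _)) !divfK ?gt_eqF // gi.
  have lt : Num.floor (N%:R * x) < Num.floor (N%:R * y).
    by rewrite lt_neqAle fxy /= le_floor ?ltW.
  apply: lt_le_trans (floorD1_gt _) _; apply: le_trans (floor_le _).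
  by rewrite ler_int !arc_lift_floor // lezD1.
- move=> x; rewrite /arc_lift (in_arcDint x 1); case: ifP => // _.
  by rewrite mulrDr mulr1 lift_natD // mulrDl divff ?gt_eqF.
- by rewrite /arc_lift mulr0 g0 mul0r if_same.
Qed.

(** A translation by a nonzero integer moves points too far, since [arc_lift g]
    keeps the integer part of [N x]; so [arc_lift g] is the identity on the arc,
    where it is a rescaled copy of [g]. *)
Lemma arc_lift_faithful g : pointed_lift g ->
  (forall x, circle_pi (arc_lift g x) = circle_pi x) -> forall x, g x = x.
Proof.
move=> gl gpi x; have [_ g1 _] := gl.
pose m := (j%:Z - Num.floor x)%:~R : R.
pose y := (x + m) / N%:R.
have yE : N%:R * y = x + m by rewrite /y mulrC divfK ?gt_eqF.
have yarc : in_arc y.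
  rewrite /in_arc yE floorDrz ?intr_int // intrKfloor.
  by rewrite [Num.floor x + _]addrC subrK subrr dvdz0.
have /circle_piP/intrP[k kE] := gpi y.
have gyE : N%:R * arc_lift g y = g x + m.
  by rewrite /arc_lift yarc mulrC divfK ?gt_eqF // yE lift_intD.
have fl := arc_lift_floor y gl.
have kN : (N%:Z * k)%:~R = g x - x :> R.
  rewrite intrM -kE mulrBr gyE yE; ring.
have /andP[a1 a2] := floor_itv x.
have := floor_itv (g x); rewrite pointed_lift_floor // => /andP[b1 b2].
have c1 : (N%:Z * k)%:~R < 1 :> R.
  by rewrite kN; move: a1 b2; rewrite rmorphD /=; lra.
have c2 : -1 < (N%:Z * k)%:~R :> R.
  by rewrite kN; move: a2 b1; rewrite rmorphD /=; lra.
have Nk0 : N%:Z * k = 0.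
  apply/eqP; rewrite eq_le -ltzD1 add0r -(ltr_int R) c1 /=.
  by have := c2; rewrite -[-1]/((-1)%:~R) ltr_int -lezD1.
by apply/eqP; rewrite -subr_eq0 -kN Nk0.
Qed.

End Arc.

Lemma dyadic_PL_id f a b : a <= b -> dyadic b ->
  (forall x, a <= x <= b -> f x = x) -> dyadic_PL f a b.
Proof.
move=> + db fE; rewrite le_eqVlt => /predU1P[->|ab]; first exact: dyadic_PL_nil.
apply: (@dyadic_PL_cons _ f a b b 0) (dyadic_PL_nil _ _) => // x abx.
by rewrite expr0z mul1r (fE x) // (fE a) ?lexx ?ltW // addrC subrK.
Qed.

(** Slopes are unchanged when source and target are rescaled alike. *)
Lemma dyadic_PL_rescale f g (N : R) (j : int) u v : 0 < N ->
  (forall a, dyadic a -> dyadic (a / N)) ->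
  dyadic_PL g u v ->
  (forall x, (u + j%:~R) / N <= x <= (v + j%:~R) / N ->
    f x = (g (N * x - j%:~R) + j%:~R) / N) ->
  dyadic_PL f ((u + j%:~R) / N) ((v + j%:~R) / N).
Proof.
move=> N0 dZ; pose r a := (a + j%:~R) / N; rewrite -!/(r _).
have rN a : N * r a - j%:~R = a by rewrite /r mulrC divfK ?gt_eqF // addrK.
have rlt a b : (r a < r b) = (a < b) by rewrite ltr_pM2r ?invr_gt0 // ltrD2r.
have rle a b : (r a <= r b) = (a <= b) by rewrite ler_pM2r ?invr_gt0 // lerD2r.
have dr a : dyadic a -> dyadic (r a).
  by move=> da; apply: dZ; apply: dyadicD => //; exact: dyadic_int.
move: u v; apply: dyadic_PL_ind => [a _|a b c k ab db gE _ bc IH fE].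
  exact: dyadic_PL_nil.
apply: (@dyadic_PL_cons _ f _ (r b) _ k).
- by rewrite rlt.
- exact: dr.
- move=> x /andP[ax xb]; rewrite (fE x) ?ax ?(le_trans xb) ?rle //.
  rewrite (fE (r a)) ?lexx ?rle ?(le_trans (ltW ab)) // rN.
  rewrite (gE (N * x - j%:~R)).
    by rewrite /r; field; rewrite gt_eqF.
  by rewrite -{1}(rN a) -{1}(rN b) !lerD2r !ler_pM2l // ax.
- by apply: IH => x /andP[bx xc]; apply: fE; rewrite xc (le_trans _ bx) ?rle ?ltW.
Qed.

Lemma in_arc_floor (N j : nat) x : (j < N)%N -> 0 <= x < 1 -> in_arc N j x ->
  Num.floor (N%:R * x) = j.
Proof.
move=> jN /andP[x0 x1] xarc.
have N0 : (0 : R) < N%:R by rewrite ltr0n (leq_trans _ jN).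
set m := Num.floor (N%:R * x) in xarc *.
have m0 : 0 <= m by rewrite floor_ge_int mulr_ge0 // ltW.
have mN : m < N by rewrite floor_lt_int gtr_pMr.
apply/eqP; rewrite -subr_eq0 -absz_eq0; apply/contraT; rewrite -lt0n => abs0.
have : (`|m - j%:Z| < N)%N.
  rewrite -ltz_nat abszE ltr_norml ltrBlDr ltrBrDr ltr_wpDr // andbT.
  by rewrite (lt_le_trans _ m0) // addrC subr_lt0 ltz_nat.
by rewrite ltnNge dvdn_leq.
Qed.

Lemma arc_lift_PL (n j : nat) g : (j < 2 ^ n)%N -> pointed_lift g ->
  dyadic_PL g 0 1 -> dyadic_PL (arc_lift (2 ^ n) j g) 0 1.
Proof.
set N := (2 ^ n)%N => jN gl gPL.
have N0 : (0 < N)%N by rewrite expn_gt0.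
have NR0 : (0 : R) < N%:R by rewrite ltr0n.
have dZ (a : R) : dyadic a -> dyadic (a / N%:R).
  by move=> /(dyadicZ (- n%:Z)); rewrite -exprnN -natrX mulrC.
have dk (k : nat) : dyadic (k%:R / N%:R : R) by apply: dZ; exact: (dyadic_int R k).
have fix_end (k : nat) : arc_lift N j g (k%:R / N%:R) = k%:R / N%:R.
  rewrite /arc_lift; case: ifP => // _; rewrite (mulrC N%:R) divfK ?gt_eqF //.
  by rewrite (pointed_lift_int k gl).
(* Both formulas fix the end points of the arc, so the pieces may be taken
   closed. *)
have off_arc x : 0 <= x <= 1 -> x <= j%:R / N%:R \/ j.+1%:R / N%:R <= x ->
    arc_lift N j g x = x.
  move=> /andP[x0]; rewrite le_eqVlt => /predU1P[->|x1].
    by have := fix_end N; rewrite divff ?gt_eqF.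
  rewrite ler_pdivlMr // ler_pdivrMr // mulrC.
  have x01 : 0 <= x < 1 by rewrite x0.
  rewrite /arc_lift; case: ifP => // /(in_arc_floor jN x01) fl.
  have := floor_itv (N%:R * x); rewrite fl intrD -!pmulrn natr1 => /andP[h1 h2].
  case=> [h3|h3]; last by have := lt_le_trans h2 h3; rewrite ltxx.
  have Nx : N%:R * x = j%:R by apply/le_anti; rewrite h3 h1.
  rewrite Nx (pointed_lift_int j gl) -[in RHS](mulKf (lt0r_neq0 NR0) x) Nx.
  exact: mulrC.
have j1N : j.+1%:R / N%:R <= 1 :> R by rewrite ler_pdivrMr // mul1r ler_nat.
have jj1 : j%:R / N%:R <= j.+1%:R / N%:R :> R.
  by rewrite ler_pM2r ?invr_gt0 // ler_nat.
have j0 : 0 <= j%:R / N%:R :> R by rewrite divr_ge0.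
apply: (@dyadic_PL_cat _ _ _ (j%:R / N%:R)).
  apply: dyadic_PL_id => // x /andP[x0 xj]; apply: off_arc; last by left.
  by rewrite x0 /= (le_trans xj) // (le_trans jj1).
apply: (@dyadic_PL_cat _ _ _ (j.+1%:R / N%:R)); last first.
  apply: dyadic_PL_id => //; first exact: (dyadic_int R 1).
  move=> x /andP[xj x1]; apply: off_arc; last by right.
  by rewrite x1 andbT (le_trans _ xj) // (le_trans j0).
have E0 : (0 + j%:~R) / N%:R = j%:R / N%:R :> R by rewrite add0r.
have E1 : (1 + j%:~R) / N%:R = j.+1%:R / N%:R :> R by rewrite nat1r.
rewrite -E0 -E1; apply: (dyadic_PL_rescale NR0 dZ gPL) => x.
rewrite E0 E1 => /andP[xj]; rewrite le_eqVlt => /predU1P[->|xj1].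
  rewrite fix_end (mulrC N%:R) divfK ?gt_eqF //.
  have -> : j.+1%:R - j%:~R = 1%:~R :> R by rewrite -natr1 addrC addKr.
  by rewrite (pointed_lift_int 1 gl) E1.
have fl : Num.floor (N%:R * x) = j.
  apply: floor_def; rewrite intrD -!pmulrn natr1 mulrC.
  by rewrite -ler_pdivrMr // xj -ltr_pdivlMr.
rewrite /arc_lift /in_arc fl subrr dvdz0; congr (_ / _).
have [_ g1 _] := gl; by rewrite -(lift_intD g1 _ j) subrK.
Qed.

End Lifts.

(** * Copies of Thompson's group supported in dyadic arcs *)

Section CircleMaps.
Variable R : realType.
Implicit Types (f g : R -> R) (z : circle R).

Lemma circle_pi_surj z : exists x, circle_pi x = z.
Proof.
by exists (repr (z : {eq_quot (circle_equiv R)})); exact: reprK.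
Qed.

(** An arbitrary section of the projection; maps commuting with integer
    translations do not see the choice. *)
Definition circle_repr z : R := xget 0 [set x | circle_pi x = z].

Lemma circle_reprK z : circle_pi (circle_repr z) = z.
Proof.
have [x xz] := circle_pi_surj z.
exact: (@xgetI _ 0 [set y : R | circle_pi y = z] x).
Qed.

Lemma circle_repr_pi x : exists m : int, circle_repr (circle_pi x) = x + m%:~R.
Proof.
have /circle_piP/intrP[m mE] := circle_reprK (circle_pi x).
by exists m; rewrite -mE addrC subrK.
Qed.

Definition circle_map f z : circle R := circle_pi (f (circle_repr z)).

Lemma circle_map_pi f x : (forall x, f (x + 1) = f x + 1) ->
  circle_map f (circle_pi x) = circle_pi (f x).
Proof.
move=> f1; have [m mE] := circle_repr_pi x.
apply/circle_piP; rewrite mE lift_intD // addrAC subrr add0r; exact: intr_int.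
Qed.

Lemma circle_map_continuous f : continuous f ->
  (forall x, f (x + 1) = f x + 1) -> continuous (circle_map f).
Proof.
move=> fc f1; apply/quotient_continuous.
have -> : circle_map f \o \pi_(quotient_topology {eq_quot (circle_equiv R)})%qT =
    @circle_pi R \o f by apply/funext => x; exact: circle_map_pi.
by move=> x; apply: continuous_comp; [exact: fc|exact: pi_continuous].
Qed.

(** Two lifts of the same map differ by integers; fixing 0, they have the same
    integer parts, so the difference is 0. *)
Lemma increasing_lift_unique (h : circle R -> circle R) f g :
  increasing_lift h f -> f 0 = 0 -> increasing_lift h g -> g 0 = 0 -> f =1 g.
Proof.
move=> [fc fi f1 fh] f0 [gc gi g1 gh] g0 x.
have /circle_piP/intrP[k kE] : circle_pi (f x) = circle_pi (g x).
  by rewrite fh gh.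
have /andP[a1 a2] := floor_itv (f x); have /andP[b1 b2] := floor_itv (g x).
have fl : Num.floor (f x) = Num.floor x by exact: pointed_lift_floor.
have gl : Num.floor (g x) = Num.floor x by exact: pointed_lift_floor.
rewrite fl in a1 a2; rewrite gl in b1 b2.
rewrite intrD in a2; rewrite intrD in b2.
have c1 : k%:~R < 1 :> R by rewrite -kE; lra.
have c2 : (-1)%:~R < k%:~R :> R by rewrite -kE rmorphN /=; lra.
rewrite ltr_int -lezD1 addNr in c2; rewrite (ltr_int R k 1) in c1.
have k0 : k = 0 by apply/le_anti; rewrite c2 -ltzD1 add0r c1.
by apply/eqP; rewrite -subr_eq0 kE k0.
Qed.

End CircleMaps.

Section ArcCopies.
Variables (R : realType).
Local Notation F := (subgroup (thompsonF R : groupClosed (homeo (circle R)))).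

Lemma thompson_lift_subproof (h : F) : exists g : R -> R,
  [/\ pointed_lift g, increasing_lift (val h) g & dyadic_PL g 0 1].
Proof.
have := valP h; rewrite inE => /is_thompsonFP[g [gl g0 gPL]].
by exists g; split => //; case: gl.
Qed.

(** Fixing the value at 0 makes the lift unique, hence multiplicative in [h]. *)
Definition thompson_lift (h : F) : R -> R :=
  projT1 (cid (thompson_lift_subproof h)).

Lemma thompson_liftP (h : F) : [/\ pointed_lift (thompson_lift h),
  increasing_lift (val h) (thompson_lift h) & dyadic_PL (thompson_lift h) 0 1].
Proof. exact: (projT2 (cid (thompson_lift_subproof h))). Qed.

Lemma thompson_liftM (h k : F) :
  thompson_lift (h * k)%g =1 thompson_lift h \o thompson_lift k.
Proof.
have [_ lhk _] := thompson_liftP (h * k)%g.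
have [[_ _ h0] [hc hi h1 hh] _] := thompson_liftP h.
have [[_ _ k0] [kc ki k1 kk] _] := thompson_liftP k.
have [[_ _ hk0] _ _] := thompson_liftP (h * k)%g.
apply: (increasing_lift_unique lhk hk0); last by rewrite /= k0 h0.
split.
- by move=> x; apply: continuous_comp; [exact: kc|exact: hc].
- by move=> x y /ki/hi.
- by move=> x; rewrite /= k1 h1.
- by move=> x; rewrite /= hh kk.
Qed.

Lemma thompson_lift1 : thompson_lift 1%g =1 idfun.
Proof.
have [[_ _ l0] l _] := thompson_liftP 1%g.
apply: (increasing_lift_unique l l0) => //.
by split => // x; exact: cvg_id.
Qed.

Variables (n j : nat).
Hypothesis jn : (j < 2 ^ n)%N.

Definition dyadic_arc : set (circle R) :=
  [set z | in_arc (2 ^ n) j (circle_repr z)].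

Let N0 : (0 < 2 ^ n)%N. Proof. by rewrite expn_gt0. Qed.

Lemma arc_pi x : dyadic_arc (circle_pi x) <-> in_arc (2 ^ n) j x.
Proof.
by rewrite /dyadic_arc /=; have [m ->] := circle_repr_pi x; rewrite in_arcDint.
Qed.

Definition thompson_arc_lift (h : F) : R -> R :=
  arc_lift (2 ^ n) j (thompson_lift h).

Lemma thompson_arc_liftM (h k : F) x :
  thompson_arc_lift (h * k)%g x = thompson_arc_lift h (thompson_arc_lift k x).
Proof.
have [kl _ _] := thompson_liftP k.
rewrite /thompson_arc_lift arc_lift_comp // /arc_lift.
by rewrite thompson_liftM.
Qed.

Lemma thompson_arc_lift1 x : thompson_arc_lift 1%g x = x.
Proof.
rewrite -[RHS](arc_lift_id j N0) /thompson_arc_lift /arc_lift.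
by rewrite thompson_lift1.
Qed.

Lemma thompson_arc_liftK (h : F) :
  cancel (thompson_arc_lift h) (thompson_arc_lift h^-1%g).
Proof. by move=> x; rewrite -thompson_arc_liftM mulVg thompson_arc_lift1. Qed.

Lemma thompson_arc_liftVK (h : F) :
  cancel (thompson_arc_lift h^-1%g) (thompson_arc_lift h).
Proof. by move=> x; rewrite -thompson_arc_liftM mulgV thompson_arc_lift1. Qed.

Lemma thompson_arc_lift_pointed (h : F) : pointed_lift (thompson_arc_lift h).
Proof. by have [hl _ _] := thompson_liftP h; exact: pointed_arc_lift. Qed.

Lemma thompson_arc_lift_continuous (h : F) : continuous (thompson_arc_lift h).
Proof.
have [i _ _] := thompson_arc_lift_pointed h^-1%g.
apply: increasing_inv_continuous i _ _; first exact: thompson_arc_liftK.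
exact: thompson_arc_liftVK.
Qed.

Definition arc_map (h : F) : circle R -> circle R :=
  circle_map (thompson_arc_lift h).

Lemma arc_map_pi (h : F) x :
  arc_map h (circle_pi x) = circle_pi (thompson_arc_lift h x).
Proof. by apply: circle_map_pi; case: (thompson_arc_lift_pointed h). Qed.

Lemma arc_map_continuous (h : F) : continuous (arc_map h).
Proof.
apply: circle_map_continuous; first exact: thompson_arc_lift_continuous.
by case: (thompson_arc_lift_pointed h).
Qed.

Lemma arc_mapK (h : F) : cancel (arc_map h) (arc_map h^-1%g).
Proof.
move=> z; have [x <-] := circle_pi_surj z.
by rewrite !arc_map_pi thompson_arc_liftK.
Qed.

Lemma arc_mapVK (h : F) : cancel (arc_map h^-1%g) (arc_map h).
Proof.
move=> z; have [x <-] := circle_pi_surj z.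
by rewrite !arc_map_pi thompson_arc_liftVK.
Qed.

Definition arc_copy (h : F) : homeo (circle R) :=
  Homeo (arc_mapK h) (arc_mapVK h) (@arc_map_continuous h)
    (@arc_map_continuous h^-1%g).

Lemma arc_copyM (h k : F) : arc_copy (h * k)%g = (arc_copy h * arc_copy k)%g.
Proof.
apply: homeoP => z; have [x <-] := circle_pi_surj z.
by rewrite /= !arc_map_pi thompson_arc_liftM.
Qed.

Lemma arc_copy_supported (h : F) z : ~ dyadic_arc z -> arc_copy h z = z.
Proof.
have [x <-] := circle_pi_surj z => /(contra_not (arc_pi x).2)/negP/negbTE xarc.
by rewrite /= arc_map_pi /thompson_arc_lift /arc_lift xarc.
Qed.

Lemma arc_copy_inj (h : F) : arc_copy h = 1%g -> h = 1%g.
Proof.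
move=> h1; have [hl [_ _ _ hh] _] := thompson_liftP h.
have gid : forall x, thompson_lift h x = x.
  apply: (@arc_lift_faithful R (2 ^ n) j N0 _ hl) => x.
  by rewrite -[LHS]arc_map_pi -[LHS]/(arc_copy h (circle_pi x)) h1.
apply: val_inj; apply: homeoP => z; have [x <-] := circle_pi_surj z.
by rewrite -hh gid.
Qed.

Lemma arc_copy_thompson (h : F) : arc_copy h \in thompsonF R.
Proof.
have [hl _ hPL] := thompson_liftP h.
have [i p z] := thompson_arc_lift_pointed h.
rewrite inE; apply/is_thompsonFP; exists (thompson_arc_lift h); split => //.
  split => //; first exact: thompson_arc_lift_continuous.
  by move=> x; rewrite /= arc_map_pi.
exact: arc_lift_PL.
Qed.

End ArcCopies.

(** * Disjoint arcs displaced by given homeomorphisms *)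

Section DisplacedArcs.
Variable R : realType.
Implicit Types (t : homeo (circle R)) (x y : R).

(** The projection is an open map: the preimage of the image of an interval is the
    union of its integer translates. *)
Lemma circle_ball_open y (e : R) :
  open [set z : circle R | exists2 u, circle_pi u = z & `|u - y| < e].
Proof.
suff : open [set v : R | exists2 u, circle_pi u = circle_pi v & `|u - y| < e] by [].
rewrite openE => v [u uv uy]; have /circle_piP/intrP[k kE] := uv.
rewrite /interior; apply/nbhs_ballP; exists (e - `|u - y|) => /=.
  by rewrite subr_gt0.
move=> w /=; rewrite /ball /= => vw; exists (w + k%:~R).
  by apply/circle_piP; rewrite addrAC subrr add0r; exact: intr_int.
have -> : w + k%:~R - y = (w - v) + (u - y) by rewrite -kE; ring.
by apply: le_lt_trans (ler_normD _ _) _; rewrite distrC -ltrBrDr.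
Qed.

Lemma not_int_separated (w : R) : w \isn't a Num.int ->
  exists2 e : R, 0 < e & forall m : int, e <= `|w - m%:~R|.
Proof.
move=> wI; have /andP[] := floor_itv w; rewrite le_eqVlt => /predU1P[E|w1 w2].
  by move: wI; rewrite -E intr_int.
rewrite intrD in w2.
exists (Num.min (w - (Num.floor w)%:~R) ((Num.floor w)%:~R + 1 - w)).
  by rewrite lt_min !subr_gt0 w1.
move=> m; have [mf|fm] := leP m (Num.floor w).
  apply: le_trans (ler_norm _); rewrite ge_min lerD2l lerN2.
  by rewrite ler_int mf.
rewrite distrC; apply: le_trans (ler_norm _); rewrite ge_min lerD2r.
by move: fm; rewrite -lezD1 -(ler_int R) intrD => ->; rewrite orbT.
Qed.

Lemma circle_pi_surj01 (z : circle R) :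
  exists2 x : R, circle_pi x = z & 0 <= x < 1.
Proof.
have [x0 x0z] := circle_pi_surj z; exists (x0 - (Num.floor x0)%:~R).
  rewrite -x0z; apply/circle_piP; rewrite addrAC subrr add0r rpredN.
  exact: intr_int.
have /andP[h1 h2] := floor_itv x0; rewrite intrD in h2.
by rewrite subr_ge0 h1 ltrBlDr addrC.
Qed.

(** The circle is Hausdorff: a moved point and its image have disjoint
    neighbourhoods, and by continuity a whole interval around the point lands in
    the second one. *)
Lemma displaced_interval t : t != 1%g ->
  exists x (d : R), [/\ 0 <= x < 1, 0 < d &
    forall y y', `|y - x| < d -> `|y' - x| < d -> t (circle_pi y) <> circle_pi y'].
Proof.
move=> t1; have [z tz] : exists z, t z <> z.
  apply: contrapT => /forallNP h; move/eqP: t1; apply; apply: homeoP => z.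
  by apply: contrapT; exact: h.
have [x xz x01] := circle_pi_surj01 z; have [y0 y0z] := circle_pi_surj (t z).
have [e e0 sep] : exists2 e : R, 0 < e & forall m : int, e <= `|y0 - x - m%:~R|.
  apply: not_int_separated; apply/negP => /circle_piP E.
  by apply: tz; rewrite -y0z -xz.
pose W := [set z : circle R | exists2 u, circle_pi u = z & `|u - y0| < e / 2].
have tc : continuous (t \o @circle_pi R).
  move=> v; apply: continuous_comp; first exact: pi_continuous.
  exact: homeo_continuous.
have Wx : nbhs x ((t \o @circle_pi R) @^-1` W).
  apply: tc; apply: open_nbhs_nbhs; split; first exact: circle_ball_open.
  by exists y0; rewrite /= ?xz // subrr normr0 divr_gt0.
have /nbhs_ballP[d /= d0 dW] := Wx.
exists x, (Num.min d (e / 2)); split => //.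
  by rewrite lt_min d0 divr_gt0.
move=> y y'; rewrite !lt_min => /andP[yd _] /andP[_ yd'] E.
have [u uy uy0] : W (t (circle_pi y)) by apply: dW; rewrite /ball /= distrC.
have /circle_piP/intrP[m mE] : circle_pi u = circle_pi y' by rewrite uy.
have := sep m; rewrite leNgt => /negP; apply.
have -> : y0 - x - m%:~R = (y0 - u) + (y' - x) by rewrite -mE; ring.
apply: le_lt_trans (ler_normD _ _) _; rewrite (distrC y0).
by rewrite [ltRHS]splitr; exact: ltrD.
Qed.

Lemma arc_floor (n j : nat) y : (j < 2 ^ n)%N -> 0 <= y < 1 ->
  dyadic_arc n j (circle_pi y) -> Num.floor ((2 ^ n)%:R * y) = j.
Proof. by move=> jn y01 /arc_pi; exact: in_arc_floor. Qed.

Lemma arc_point (n j : nat) (z : circle R) : (j < 2 ^ n)%N -> dyadic_arc n j z ->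
  exists2 y : R, circle_pi y = z & j%:R <= (2 ^ n)%:R * y < j.+1%:R.
Proof.
move=> jn; have [y <- y01] := circle_pi_surj01 z => /(arc_floor jn y01) fl.
exists y => //.
by have := floor_itv ((2 ^ n)%:R * y); rewrite fl intrD -!pmulrn natr1.
Qed.

Lemma arcs_disjoint (n i j : nat) : (i < 2 ^ n)%N -> (j < 2 ^ n)%N -> i <> j ->
  @dyadic_arc R n i `&` dyadic_arc n j = set0.
Proof.
move=> iN jN ij; apply/seteqP; split => // z.
have [y <- y01] := circle_pi_surj01 z.
by move=> [/(arc_floor iN y01) fi /(arc_floor jN y01)]; rewrite fi => -[].
Qed.

Lemma common_lower_bound (d : nat -> R) (m : nat) :
  (forall i, (i < m)%N -> 0 < d i) ->
  exists2 e : R, 0 < e & forall i, (i < m)%N -> e <= d i.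
Proof.
elim: m => [|m IH] d0; first by exists 1.
have [i im|e e0 de] := IH; first by apply: d0; exact: ltnW.
exists (Num.min e (d m)); first by rewrite lt_min e0 d0.
move=> i; rewrite ltnS leq_eqVlt => /predU1P[->|im].
  by rewrite ge_min lexx orbT.
by rewrite ge_min de.
Qed.

Lemma norm_lt1 (a x y : R) :
  a <= x -> x < a + 1 -> a <= y -> y < a + 1 -> `|x - y| < 1.
Proof. by move=> *; rewrite ltr_norml; apply/andP; split; lra. Qed.

(** Cut the circle into [P] cells with [P^-1] smaller than the radii of the
    displaced intervals, then each cell into [M = 2 ^ m] arcs, and take for the
    [i]-th element the [i]-th arc in the cell of its point.  All arcs have the
    same length, and different positions in the cells make them disjoint. *)
Lemma displaced_arcs (ts : seq (homeo (circle R))) :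
  (forall t, t \in ts -> t != 1%g) ->
  exists (n : nat) (j : nat -> nat),
    [/\ forall i, (i < size ts)%N -> (j i < 2 ^ n)%N,
        forall i k, (i < size ts)%N -> (k < size ts)%N -> i <> k -> j i <> j k &
        forall i z, (i < size ts)%N ->
          dyadic_arc n (j i) z -> ~ dyadic_arc n (j i) (nth 1%g ts i z)].
Proof.
move=> ts1; set m := size ts.
have /choice[xd xdP] : forall i, exists xd : R * R, (i < m)%N ->
    [/\ 0 <= xd.1 < 1, 0 < xd.2 & forall y y', `|y - xd.1| < xd.2 ->
      `|y' - xd.1| < xd.2 -> nth 1%g ts i (circle_pi y) <> circle_pi y'].
  move=> i; have [im|_] := boolP (i < m)%N; last by exists (0, 0).
  by have [x [d h]] := displaced_interval (ts1 _ (mem_nth 1%g im)); exists (x, d).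
have [i im|e e0 de] := @common_lower_bound (fun i => (xd i).2) m.
  by have [] := xdP i im.
pose p := (Num.truncn e^-1).+1; pose P := (2 ^ p)%N; pose M := (2 ^ m)%N.
have P0 : (0 : R) < P%:R by rewrite ltr0n expn_gt0.
have M0 : (0 : R) < M%:R by rewrite ltr0n expn_gt0.
have Pe : P%:R^-1 < e.
  rewrite invf_plt ?posrE //; apply: lt_trans (truncnS_gt _) _.
  by rewrite ltr_nat; exact: ltn_expl.
have NE : (2 ^ (p + m))%:R = P%:R * M%:R :> R by rewrite expnD natrM.
have mM : (m < M)%N by exact: ltn_expl.
pose a i := Num.truncn (P%:R * (xd i).1).
have aP i : (i < m)%N -> (a i)%:R <= P%:R * (xd i).1 < (a i).+1%:R.
  move=> im; have [/andP[x0 _] _ _] := xdP i im.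
  by apply: truncn_itv; rewrite mulr_ge0 // ltW.
have aM i : (i < m)%N -> (a i * M + i < (a i).+1 * M)%N.
  by move=> im; rewrite mulSn addnC ltn_add2r (ltn_trans im).
have jN i : (i < m)%N -> (a i * M + i < 2 ^ (p + m))%N.
  move=> im; apply: (leq_trans (aM i im)).
  rewrite expnD leq_mul2r; apply/orP; right.
  rewrite -(ltr_nat R); apply: (@le_lt_trans _ _ (P%:R * (xd i).1)).
    by have /andP[] := aP i im.
  by have [/andP[_ x1] _ _] := xdP i im; rewrite gtr_pMr.
exists (p + m)%N, (fun i => a i * M + i)%N; split=> //.
- move=> i k im km ik E; apply: ik.
  have := congr1 (fun l : nat => l %% M)%N E.
  by rewrite /= !modnMDl !modn_small // (ltn_trans _ mM).
move=> i z im zi zi'; have [_ _ disp] := xdP i im.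
have near y : (a i * M + i)%:R <= (2 ^ (p + m))%:R * y < (a i * M + i).+1%:R ->
    `|y - (xd i).1| < (xd i).2.
  rewrite NE => /andP[y1 y2]; apply: lt_le_trans (de i im).
  have /andP[a1 a2] := aP i im.
  have y1' : (a i)%:R <= P%:R * y.
    rewrite -(ler_pM2r M0) mulrAC; apply: le_trans y1.
    by rewrite -natrM ler_nat leq_addr.
  have y2' : P%:R * y < (a i).+1%:R.
    rewrite -(ltr_pM2r M0) mulrAC; apply: (lt_le_trans y2).
    by rewrite -natrM ler_nat; exact: aM.
  apply: lt_trans Pe; rewrite -(ltr_pM2l P0) divff ?gt_eqF //.
  rewrite -[X in X * `|_|]gtr0_norm // -normrM mulrBr.
  rewrite -natr1 in a2 y2'; exact: norm_lt1 y1' y2' a1 a2.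
have [y yz /near yx] := arc_point (jN i im) zi.
have [y' yz' /near yx'] := arc_point (jN i im) zi'.
by apply: (disp y y') => //; rewrite yz yz'.
Qed.

End DisplacedArcs.

(** * Overgroups of Thompson's group *)

Theorem theorem4p1 (R : realType)
  (F_nonamenable : ~ amenable R (subgroup (thompsonF R : groupClosed (homeo (circle R)))))
  (G : groupClosed (homeo (circle R)))
  (G_countable : countable [set` G])
  (F_sub_G : {subset thompsonF R <= G}) :
  cstar_simple R (subgroup G).
Proof.
pose act (g : subgroup G) (z : circle R) := val g z.
have actI g h : (forall z, act g z = act h z) -> g = h.
  by move=> gh; apply: val_inj; apply: homeoP.
apply: (@averaging_domains_cstar_simple R _ _ act) => // ts ts1.
have [t|n [j [jn jinj disp]]] := @displaced_arcs R (map val ts).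
  move=> /mapP[g gts ->]; apply: contra (ts1 g gts) => /eqP g1.
  by apply/eqP/val_inj.
rewrite size_map in jn jinj disp.
exists (fun i => dyadic_arc n (j i)); split => [i im|i k im km ik|i im].
- have memG h : arc_copy n (j i) h \in G.
    by apply: F_sub_G; exact: arc_copy_thompson (jn i im) h.
  pose iota h : subgroup G :=
    exist (fun x => x \in G) (arc_copy n (j i) h) (memG h).
  apply: (@averaging_domain_nonamenable R _ _ act _ _ _ _ iota _ F_nonamenable)
    => //.
  + by move=> h k; apply: val_inj; exact: arc_copyM.
  + move=> h h1; apply: (@arc_copy_inj R n (j i)); exact: (congr1 val h1).
  + by move=> h z; exact: arc_copy_supported.
- by apply: arcs_disjoint; [exact: jn|exact: jn|exact: jinj].
- move=> z zi; have := disp i z im zi.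
  by rewrite (nth_map 1%g).
Qed.
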